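(* Let $\tau:[0,1]\to[0,1]$ be piecewise monotonic and surjective. Then the C*-algebra $F_\tau$ is simple if and only if $\tau$ is topologically exact.
   Context: Let $I=[0,1]$. A map $\tau:I\to I$ is piecewise monotonic if there are points $0=a_0<a_1<\dots<a_n=1$ such that each $\tau|_{(a_{i-1},a_i)}$ is continuous and strictly monotonic; the $a_i$ are chosen so that no $(a_{i-1},a_i)$ is contained in a larger open interval on which $\tau$ is continuous and strictly monotonic. $C=\{a_0,\dots,a_n\}$ is the partition associated with $\tau$, and $\tau_i:[a_{i-1},a_i]\to I$ is the continuous extension of $\tau|_{(a_{i-1},a_i)}$. The actual values of $\tau$ at discontinuities are ignored: for $A\subset I$ put $\widehat\tau(A)=\bigcup_i\tau_i(A\cap[a_{i-1},a_i])$ and $\widehat\tau^{-1}(A)=\bigcup_i\{x\in[a_{i-1},a_i]:\tau_i(x)\in A\}$. Surjectivity of $\tau$ means $\widehat\tau(I)=I$. Associated local homeomorphism: $I_1$ is the smallest subset of $I$ containing $C$ and forward and backward invariant under $\widehat\tau$; $I_0=I\setminus I_1$. $X$ is the totally ordered set obtained from $I$ by replacing each $x\in I_1\setminus\{0,1\}$ by two points $x^-<x^+$, with the order topology ($X$ is homeomorphic to a compact subset of $\mathbb R$). $\pi:X\to I$ is the collapse map ($\pi(x^\pm)=x$ for $x\in I_1$, $\pi(x)=x$ otherwise), and $X_0=\pi^{-1}(I_0)$. There is a unique continuous $\sigma:X\to X$ with $\pi\circ\sigma=\tau\circ\pi$ on $X_0$; it is a local homeomorphism. C*-algebra: $R_n=\{(x,y)\in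 X\times X:\sigma^nx=\sigma^ny\}$ with the topology from $X\times X$, and $R(X,\sigma)=\bigcup_nR_n$ with the inductive limit topology. $C_c(R(X,\sigma))$ is a *-algebra with $(f\star g)(x,y)=\sum_{z:(x,z)\in R(X,\sigma)}f(x,z)g(z,y)$ and $f^*(x,y)=\overline{f(y,x)}$; it has a unique C*-norm, and $F_\tau=C^*(R(X,\sigma))$ is its completion. $\tau$ is topologically exact if for every non-empty open $U\subset I$ there is $n$ with $\widehat\tau^{\,n}(U)=I$. *)

(* Defs.v *)
From HB Require Import structures.
From mathcomp Require Import all_boot all_order all_algebra.
From mathcomp Require Import all_classical all_reals all_analysis.
From mathcomp Require Import complex.

Set Implicit Arguments.
Unset Strict Implicit.
Unset Printing Implicit Defensive.

Import Order.TTheory GRing.Theory Num.Theory.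
Import numFieldNormedType.Exports.

Local Open Scope classical_set_scope.
Local Open Scope ring_scope.

(* The usual topology and norm of the complex numbers [R[i]]. *)
HB.instance Definition _ (R : realType) := NormedModule.copy R[i] R[i]^o.

Section PiecewiseMonotonic.
Context {R : realType}.
Implicit Types (tau : R -> R) (c : seq R) (A : set R).

(* Maps of the unit interval are represented by functions [R -> R] that map
   [unitI] to itself; their values outside [unitI] play no role. *)
Definition unitI : set R := `[0, 1]%classic.

(* [/~] reverses the order: strictly decreasing. *)
Definition cont_strict_mono tau (u v : R) : Prop :=
  {in `]u, v[, continuous tau} /\
  ({in `]u, v[ &, {homo tau : x y / x < y}} \/
   {in `]u, v[ &, {homo tau : x y /~ x < y}}).

Definition monotone_partition tau c : Prop :=
  [/\ sorted <%R c, c`_0 = 0, last 0 c = 1 &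
    forall i, (i.+1 < size c)%N -> cont_strict_mono tau c`_i c`_i.+1].

Definition piecewise_monotonic tau : Prop :=
  (forall x, unitI x -> unitI (tau x)) /\ exists c, monotone_partition tau c.

Definition maximal_partition tau c : Prop :=
  monotone_partition tau c /\
  forall i, (i.+1 < size c)%N -> forall u v : R,
    0 <= u -> u <= c`_i -> c`_i.+1 <= v -> v <= 1 ->
    cont_strict_mono tau u v -> u = c`_i /\ v = c`_i.+1.

(* The maximal partition is unique when [tau] is piecewise monotonic. *)
Definition pm_partition tau : seq R := xget [::] (maximal_partition tau).

(* [tau_i], the continuous extension of [tau] from the i-th open interval of
   the partition to its closure. *)
Definition branch tau (i : nat) (x : R) : R :=
  let a := (pm_partition tau)`_i in
  let b := (pm_partition tau)`_i.+1 in
  if x == a then lim (tau y @[y --> a^'+])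
  else if x == b then lim (tau y @[y --> b^'-])
  else tau x.

Definition branch_dom tau (i : nat) : set R :=
  `[(pm_partition tau)`_i, (pm_partition tau)`_i.+1]%classic.

Definition hat tau A : set R :=
  \bigcup_(i in [set i | (i.+1 < size (pm_partition tau))%N])
    (branch tau i @` (A `&` branch_dom tau i)).

Definition hat_inv tau A : set R :=
  \bigcup_(i in [set i | (i.+1 < size (pm_partition tau))%N])
    (branch_dom tau i `&` branch tau i @^-1` A).

Definition hat_surjective tau : Prop := hat tau unitI = unitI.

Definition topologically_exact tau : Prop :=
  forall U : set R, open U -> U `&` unitI !=set0 ->
  exists n, iter n (hat tau) (U `&` unitI) = unitI.

Definition I1 tau : set R :=
  smallest [set M | [/\ M `<=` unitI, hat tau M `<=` M & hat_inv tau M `<=` M]]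
    [set` pm_partition tau].

Definition I0 tau : set R := unitI `\` I1 tau.

(* The points of [X]: [(x, false)] is [x^-] and [(x, true)] is [x^+] when [x]
   is doubled, and [(x, false)] is [x] when it is not. *)
Definition split_points tau : set (R *l bool) :=
  [set p : R * bool | unitI p.1 /\ (p.2 -> I1 tau p.1 /\ 0 < p.1 < 1)].

Definition splitI tau : Type := {p : R *l bool | p \in split_points tau}.

HB.instance Definition _ tau := SubType.on (splitI tau).
HB.instance Definition _ tau := [Choice of splitI tau by <:].
HB.instance Definition _ tau :=
  [SubChoice_isSubOrder of splitI tau by <: with ring_display].

Definition X tau := order_topology (splitI tau).

Definition collapse tau (p : X tau) : R := (val (p : splitI tau)).1.

Definition X0 tau : set (X tau) := @collapse tau @^-1` I0 tau.

(* [X0 tau] is dense, so these conditions determine [s] uniquely; that [s]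
   exists and is a local homeomorphism is a theorem. *)
Definition associated_map tau (s : X tau -> X tau) : Prop :=
  continuous s /\
  forall p, X0 p -> collapse (s p) = tau (collapse p).

End PiecewiseMonotonic.

Section Groupoid.
Context {T : topologicalType}.
Implicit Types s : T -> T.

Definition Rn s (n : nat) : set (T * T) :=
  [set p | iter n s p.1 = iter n s p.2].

Definition Runion s : set (T * T) := \bigcup_n Rn s n.

Definition Rel s : Type := {p : T * T | p \in Runion s}.

HB.instance Definition _ s := SubType.on (Rel s).
HB.instance Definition _ s := [Choice of Rel s by <:].

(* The inductive limit topology: [U] is open when each [U `&` Rn s n] is
   relatively open in [Rn s n]. *)
Definition ilim_open s : set_system (Rel s) :=
  [set U | forall n, exists2 V : set (T * T), open V &
    forall p : Rel s, Rn s n (val p) -> (U p <-> V (val p))].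
Arguments ilim_open : clear implicits.

Lemma ilim_openT s : ilim_open s setT.
Proof. by move=> n; exists setT => //; exact: openT. Qed.

Lemma ilim_openI s : setI_closed (ilim_open s).
Proof.
move=> A B oA oB n; have [V oV AV] := oA n; have [W oW BW] := oB n.
exists (V `&` W); first exact: openI.
by move=> p Rp; split=> -[/(AV _ Rp) ? /(BW _ Rp) ?].
Qed.

Lemma ilim_open_bigU s (J : Type) (f : J -> set (Rel s)) :
  (forall i, ilim_open s (f i)) -> ilim_open s (\bigcup_i f i).
Proof.
move=> of_ n; pose W i := sval (cid2 (of_ i n)).
exists (\bigcup_i W i); first by apply: bigcup_open => i _; exact: (s2valP (cid2 (of_ i n))).
move=> p Rp; split=> -[i _ ?]; exists i => //;
  exact/(s2valP' (cid2 (of_ i n)) _ Rp).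
Qed.

HB.instance Definition _ s := isOpenTopological.Build (Rel s)
  (ilim_openT s) (@ilim_openI s) (@ilim_open_bigU s).

Context {R : realType}.
Local Notation C := R[i].

Definition Cc s : set (Rel s -> C) :=
  [set f : Rel s -> C | continuous f /\ compact (closure [set p | f p != 0])].

(* [f] extended by 0 off [Rel s]. *)
Definition ext0 s (f : Rel s -> C) (p : T * T) : C := oapp f 0 (insub p).

(* For [f], [g] in [Cc s] and [sigma] finite-to-one, only finitely many terms
   of the sum are nonzero, so that it is a genuine finite sum. *)
Definition convol s (f g : Rel s -> C) : Rel s -> C := fun p =>
  \sum_(z \in [set z | Runion s ((val p).1, z)])
    ext0 f ((val p).1, z) * ext0 g (z, (val p).2).

Definition adj s (f : Rel s -> C) : Rel s -> C := fun p =>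
  (ext0 f ((val p).2, (val p).1))^*.

(* As for the library's normed modules, norms over [C] take their values in the
   nonnegative elements of [C]. *)
Record cstar_norm s (N : (Rel s -> C) -> C) : Prop := {
  cstar_norm_ge0 : forall f, Cc f -> 0 <= N f ;
  cstar_norm_eq0 : forall f, Cc f -> N f = 0 -> f = (fun=> 0) ;
  cstar_normZ : forall (k : C) f, Cc f -> N (fun p => k * f p) = `|k| * N f ;
  cstar_normD : forall f g, Cc f -> Cc g ->
    N (fun p => f p + g p) <= N f + N g ;
  cstar_normM : forall f g, Cc f -> Cc g -> N (convol f g) <= N f * N g ;
  cstar_norm_adjM : forall f, Cc f -> N (convol (adj f) f) = N f ^+ 2
}.

End Groupoid.

Section CstarAlgebras.
Variable R : realType.
Local Notation C := R[i].

Record cstarAlgebra := CstarAlgebra {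
  cstar_sort :> completeNormedModType C ;
  cmul : cstar_sort -> cstar_sort -> cstar_sort ;
  cstar : cstar_sort -> cstar_sort ;
  cmulA : forall a b c, cmul a (cmul b c) = cmul (cmul a b) c ;
  cmulDl : forall a b c, cmul (a + b) c = cmul a c + cmul b c ;
  cmulDr : forall a b c, cmul a (b + c) = cmul a b + cmul a c ;
  cmulZl : forall (k : C) a b, cmul (k *: a) b = k *: cmul a b ;
  cmulZr : forall (k : C) a b, cmul a (k *: b) = k *: cmul a b ;
  cstarK : forall a, cstar (cstar a) = a ;
  cstarD : forall a b, cstar (a + b) = cstar a + cstar b ;
  cstarZ : forall (k : C) a, cstar (k *: a) = k^* *: cstar a ;
  cstarM : forall a b, cstar (cmul a b) = cmul (cstar b) (cstar a) ;
  cnormM : forall a b, `|cmul a b| <= `|a| * `|b| ;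
  cnorm_starM : forall a, `|cmul (cstar a) a| = `|a| ^+ 2
}.

Record closed_ideal (A : cstarAlgebra) (J : set A) : Prop := {
  ideal_closed : closed J ;
  ideal0 : J 0 ;
  idealD : forall a b, J a -> J b -> J (a + b) ;
  idealZ : forall (k : C) a, J a -> J (k *: a) ;
  idealMl : forall a b, J b -> J (cmul a b) ;
  idealMr : forall a b, J a -> J (cmul a b)
}.

Definition cstar_simple (A : cstarAlgebra) : Prop :=
  (exists a : A, a != 0) /\
  forall J : set A, closed_ideal J -> J = [set 0] \/ J = setT.

(* [A] is the completion of the *-algebra [Cc s] for the norm [N], with [iota]
   the canonical map. *)
Record completion (T : topologicalType) (s : T -> T) (N : (Rel s -> C) -> C)
    (A : cstarAlgebra) (iota : (Rel s -> C) -> A) : Prop := {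
  completionD : forall f g, Cc f -> Cc g ->
    iota (fun p => f p + g p) = iota f + iota g ;
  completionZ : forall (k : C) f, Cc f ->
    iota (fun p => k * f p) = k *: iota f ;
  completionM : forall f g, Cc f -> Cc g ->
    iota (convol f g) = cmul (iota f) (iota g) ;
  completion_star : forall f, Cc f -> iota (adj f) = cstar (iota f) ;
  completion_norm : forall f, Cc f -> `|iota f| = N f ;
  completion_dense : closure (iota @` @Cc T R s) = setT
}.

(* [A] is (a model of) [F_tau = C^*(R(X, sigma))]. Both [sigma] and the C*-norm
   exist and are unique, so this determines [A] up to *-isomorphism. *)
Definition is_F (tau : R -> R) (A : cstarAlgebra) : Prop :=
  exists2 s : X tau -> X tau, associated_map s &
  exists2 N : (Rel s -> C) -> C, cstar_norm N &
  exists iota : (Rel s -> C) -> A, completion N iota.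

End CstarAlgebras.

(* Main.v *)
Require Import Defs.
From mathcomp Require Import all_boot all_order all_algebra.
From mathcomp Require Import all_classical all_reals all_analysis.
From mathcomp Require Import complex ring lra.

Set Implicit Arguments.
Unset Strict Implicit.
Unset Printing Implicit Defensive.

Import Order.TTheory GRing.Theory Num.Theory.
Import numFieldNormedType.Exports.

Local Open Scope classical_set_scope.
Local Open Scope ring_scope.

Local Notation "x %:C" := (real_complex _ x) : ring_scope.

(* Write [E f] for the restriction of [f] in [Cc(R)] to the diagonal. The space [X]
   is compact, and [sigma] is continuous, open, and injective on finitely many
   clopen pieces, so each [R_n] is a disjoint union of finitely many clopen graphs
   of partial homeomorphisms of [X].

   Let [J] be a closed ideal of [A] containing no nonzero positive function in
   [C(X)]. Then the quotient seminorm [p] of [J] dominates the supremum norm on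
   [C(X)], and compressing by the projections onto the pieces gives
   [sup E f <= p f] when [E f >= 0]. For [f] supported in [R_n] one also has
   [|f|^2 <= K_n^2 sup E(f^* f)]. Applied to the powers [q^(2^i)] of [q = f^* f],
   which are all supported in the same [R_n], these two estimates give [|f| <= p f],
   so [J = 0]. If instead [J] contains some [b >= 0] in [C(X)] with [b <> 0] and
   [sigma] is topologically exact, then summing [b] over the classes of [R_n] for
   large [n] yields a strictly positive, hence invertible, function in [J].

   Conversely, if [A] is simple, the closure of the functions supported in the
   saturation [D] of an open set [{b > 0}] is an ideal containing [1], which forces
   [D = X], and compactness yields an [n] with [sigma^n {b > 0} = X].

   Exactness passes between [tau] and [sigma] because [I1] is countable, so that
   [X0] is dense in [X]. *)

(** * Local homeomorphisms with finitely many injective clopen pieces *)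

(** The norm is known only through its axioms on [Cc], and closed ideals come without
    self-adjointness. Every estimate is therefore extracted from the C*-identity and from the
    submultiplicativity of the distance to J; the inequality |f| <= p f says that the quotient map
    is isometric on [Cc].

    Compression works because the points of one R_n-class are separated by their itineraries:
    cutting f down on both sides by the indicator e_w of an itinerary of length n removes everything
    off the diagonal, so e_w f e_w = e_w E f. The constant K_n is the number of words of length n in
    the labels. As R_n is an equivalence relation, powers do not leave it; the constant is the same
    for all of them and disappears with the 2^i-th root.

    For J = 0 the same estimates bound E f by |f|. This is what the converse rests on: a function
    supported off a point y stays at distance at least 1 from the unit.

    The map [tau] prescribes [s] only over [I0], where lifts are unique; at doubled points the
    properties of [s] come from density of [X0], continuity and compactness. *)

(* [s] is injective on each of the clopen pieces [L @^-1` [set i]]; for the map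
   [sigma] of the context these are the blocks of [X] over the intervals of the
   partition. *)
Record labelled_covering (T : topologicalType) (s : T -> T) (k : nat)
    (L : T -> 'I_k) : Prop := LabelledCovering {
  lc_hausdorff : hausdorff_space T ;
  lc_compact : compact [set: T] ;
  lc_continuous : continuous s ;
  lc_open : forall U, open U -> open (s @` U) ;
  lc_surj : forall y, exists x, s x = y ;
  lc_label : forall x, \forall y \near x, L y = L x ;
  lc_inj : forall x y, L x = L y -> s x = s y -> x = y
}.

Section Itineraries.
Context (T : topologicalType) (s : T -> T) (k : nat) (L : T -> 'I_k).
Hypothesis sL : labelled_covering s L.

Let W n := {ffun 'I_n -> 'I_k}.

Definition itin n (x : T) : W n := [ffun i : 'I_n => L (iter i s x)].

Lemma iter_continuous n : continuous (iter n s).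
Proof.
elim: n => [|n ih] x; first exact: cvg_id.
by apply: (@continuous_comp _ _ _ (iter n s) s); [exact: ih|exact: (lc_continuous sL)].
Qed.

Lemma iter_open n U : open U -> open (iter n s @` U).
Proof.
elim: n => [|n ih] oU; first by rewrite image_id.
have -> : iter n.+1 s @` U = s @` (iter n s @` U) by rewrite image_comp.
by apply: (lc_open sL); exact: ih.
Qed.

Lemma iter_surj n y : exists x, iter n s x = y.
Proof.
elim: n y => [|n ih] y; first by exists y.
by have [z <-] := lc_surj sL y; have [x <-] := ih z; exists x.
Qed.

Lemma itin_near n x : \forall y \near x, itin n y = itin n x.
Proof.
suff: \forall y \near x, forall i : 'I_n, L (iter i s y) = L (iter i s x).
  by apply: filterS => y yx; apply/ffunP => i; rewrite !ffunE.
apply: filter_forall => i.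
exact: (@iter_continuous i x _ (lc_label sL (iter i s x))).
Qed.

(** [lc_inj] cancels one application of [s] at a time, from time [m] down to [n], so only the labels
    at these times matter. *)
Lemma iter_inj m n x y : (n <= m)%N -> iter m s x = iter m s y ->
  (forall i : 'I_m, (n <= i)%N -> L (iter i s x) = L (iter i s y)) ->
  iter n s x = iter n s y.
Proof.
elim: m => [|m ih]; first by rewrite leqn0 => /eqP ->.
rewrite leq_eqVlt => /predU1P[-> //|]; rewrite ltnS => nm sm lab.
apply: ih => //; last first.
  by move=> i ni; exact: (lab (widen_ord (leqnSn m) i)).
by apply: (lc_inj sL) => //; exact: (lab ord_max).
Qed.

Lemma itin_inj n x y : itin n x = itin n y -> iter n s x = iter n s y -> x = y.
Proof.
move=> xy; move/(@iter_inj n 0); apply => // i _.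
by have := congr1 (fun f : W n => f i) xy; rewrite !ffunE.
Qed.

Lemma open_itin2 n (P : W n -> W n -> Prop) :
  open [set q : T * T | P (itin n q.1) (itin n q.2)].
Proof.
rewrite openE => -[x y] /= Pxy.
exists (itin n @^-1` [set itin n x], itin n @^-1` [set itin n y]) => /=.
  by split; exact: itin_near.
by move=> [x' y'] [/= -> ->].
Qed.

Lemma open_itin n w : open [set x | itin n x = w].
Proof.
rewrite openE => x /= <-; exact: itin_near.
Qed.

Lemma Rn_le m n : (m <= n)%N -> Rn s m `<=` Rn s n.
Proof.
move=> /subnK <- [x y]; rewrite /Rn /= => xy.
by rewrite !iterD xy.
Qed.

Lemma RunionP q : Runion s q -> exists p : Rel s, val p = q.
Proof. by move=> Rq; exists (Sub q (mem_set Rq)); rewrite SubK. Qed.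

Lemma Rn_Runion n q : Rn s n q -> Runion s q.
Proof. by exists n. Qed.

Lemma Rel_Runion (p : Rel s) : Runion s (val p).
Proof. exact: (set_mem (valP p)). Qed.

(** Inside [Rn s m] the smaller relation becomes a condition on itineraries, which are locally
    constant; hence it is clopen there. *)
Lemma Rn_itinP m n q : Rn s m q ->
  (Rn s n q <-> forall i : 'I_m, (n <= i)%N -> itin m q.1 i = itin m q.2 i).
Proof.
case: q => x y mxy; split=> [nxy i ni|lab].
  by rewrite !ffunE -(subnK ni) !iterD; congr (L (iter _ _ _)).
have [nm|/ltnW mn] := leqP n m; last exact: (Rn_le mn).
by apply: (@iter_inj m) => // i ni; have := lab i ni; rewrite !ffunE.
Qed.

Lemma clopen_Rn n : clopen [set p : Rel s | Rn s n (val p)].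
Proof.
pose V m := fun w w' : W m => forall i : 'I_m, (n <= i)%N -> w i = w' i.
split; last rewrite -openC.
  move=> m; exists [set q | V m (itin m q.1) (itin m q.2)]; first exact: open_itin2.
  by move=> p; exact: Rn_itinP.
move=> m; exists [set q | ~ V m (itin m q.1) (itin m q.2)].
  exact: (@open_itin2 m (fun w w' => ~ V m w w')).
by move=> p /(Rn_itinP n) pn; split=> np; apply: contra_not np => /pn.
Qed.

Lemma closed_Rn n : closed (Rn s n).
Proof.
rewrite -openC openE => -[x y] /= /eqP xy.
have := lc_hausdorff sL; rewrite open_hausdorff => /(_ _ _ xy).
move=> [[A B]] /= [xA yB] [oA oB AB].
exists (iter n s @^-1` A, iter n s @^-1` B) => /=.
  split; apply: iter_continuous; apply: open_nbhs_nbhs; split=> //; exact: set_mem.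
move=> [x' y'] [/= Ax By]; rewrite /Rn /= => xy'.
by have : (A `&` B) (iter n s x') by [split=> //; rewrite xy']; rewrite (eqP AB).
Qed.

End Itineraries.

Lemma near_eq_continuous (T U : topologicalType) (f g : T -> U) (x : T) :
  (\forall y \near x, f y = g y) -> {for x, continuous f} -> {for x, continuous g}.
Proof.
move=> fg cf; have fgx : f x = g x := nbhs_singleton fg.
by change (g @ x --> g x); rewrite -fgx; apply: cvg_trans cf; exact: near_eq_cvg.
Qed.

(** * The convolution algebra as matrix-valued functions *)

(* [s^n] is injective on the set of points with [n]-itinerary [w], with inverse
   [pre w] on the clopen set [img w] (off which [pre w t] is [t]). A function on [R_n] thus amounts to the
   function [t |-> (f (pre w t, pre w' t))_(w, w')] with values in matrices
   indexed by itineraries, and convolution becomes the matrix product. *)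
Section FiberMatrices.
Context (T : topologicalType) (s : T -> T) (k : nat) (L : T -> 'I_k).
Context (R : realType).
Hypothesis sL : labelled_covering s L.
Local Notation C := R[i].
Let W n := {ffun 'I_n -> 'I_k}.
Local Notation itin := (itin s L).
Implicit Types (f g : Rel s -> C) (n : nat).

Definition img n (w : W n) : set T := iter n s @` [set z | itin n z = w].

Definition pre n (w : W n) (t : T) : T :=
  xget t [set z | itin n z = w /\ iter n s z = t].

Lemma preP n (w : W n) t : img w t ->
  itin n (pre w t) = w /\ iter n s (pre w t) = t.
Proof. by move=> [z zw zt]; rewrite /pre; case: xgetP => // /(_ z)[]. Qed.

Lemma img_itin n z : img (itin n z) (iter n s z).
Proof. by exists z. Qed.

Lemma pre_itin n z : pre (itin n z) (iter n s z) = z.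
Proof. by have [iz sz] := preP (img_itin n z); exact: (itin_inj sL iz sz). Qed.

Lemma open_img n (w : W n) : open (img w).
Proof. by apply: (iter_open sL); exact: (open_itin sL). Qed.

(** The points with a given itinerary form a clopen, hence compact, set. As its image is both open
    and closed, setting a matrix entry to 0 outside the image preserves continuity. *)
Lemma closed_img n (w : W n) : closed (img w).
Proof.
apply: (compact_closed (lc_hausdorff sL)); apply: continuous_compact.
  by apply: continuous_subspaceT; exact: (iter_continuous sL).
apply: (subclosed_compact _ (lc_compact sL)) => //.
rewrite -openC openE => x /= xw.
by apply: filterS (itin_near sL n x) => y /= ->.
Qed.

Lemma pre_continuous n (w : W n) t : img w t -> {for t, continuous (pre w)}.
Proof.
move=> wt; have [iz sz] := preP wt; set z := pre w t in iz sz *.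
move=> V; rewrite -/z nbhsE => -[U [oU Uz] UV].
suff: nbhs t (pre w @^-1` V) by []; rewrite nbhsE.
exists (iter n s @` (U `&` [set z | itin n z = w])); last first.
  by move=> _ [y [Uy yw] <-] /=; apply: UV; rewrite -yw pre_itin.
split; last by exists z.
by apply: (iter_open sL); apply: openI => //; exact: (open_itin sL).
Qed.

Lemma val_continuous : continuous (val : Rel s -> T * T).
Proof.
apply/continuousP => V oV; suff: ilim_open (\val @^-1` V : set (Rel s)) by [].
by move=> n; exists V.
Qed.

Lemma ext0_val f p : ext0 f (val p) = f p.
Proof. by rewrite /ext0 valK. Qed.

Lemma ext0_out f q : ~ Runion s q -> ext0 f q = 0.
Proof.
by move=> Rq; rewrite /ext0 insubN//; apply/negP => /set_mem.
Qed.

Lemma ext0D f g q : ext0 (fun p : Rel s => f p + g p) q = ext0 f q + ext0 g q.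
Proof.
have [/RunionP[p <-]|nq] := pselect (Runion s q); first by rewrite !ext0_val.
by rewrite !ext0_out ?addr0.
Qed.

Lemma ext0Z (a : C) f q : ext0 (fun p : Rel s => a * f p) q = a * ext0 f q.
Proof.
have [/RunionP[p <-]|nq] := pselect (Runion s q); first by rewrite !ext0_val.
by rewrite !ext0_out ?mulr0.
Qed.

Definition level n f := forall q, ~ Rn s n q -> ext0 f q = 0.

Lemma levelP n f : (forall p, ~ Rn s n (val p) -> f p = 0) -> level n f.
Proof.
move=> fn q Rq; have [/RunionP[p pq]|] := pselect (Runion s q); last exact: ext0_out.
by rewrite -pq ext0_val; apply: fn; rewrite pq.
Qed.

Lemma level_le m n f : (m <= n)%N -> level m f -> level n f.
Proof. by move=> mn fm q Rq; apply: fm; apply: contra_not Rq; exact: Rn_le. Qed.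

Definition mat n f (w w' : W n) (t : T) : C :=
  if `[< img w t /\ img w' t >] then ext0 f (pre w t, pre w' t) else 0.

Lemma matE n f x y : iter n s x = iter n s y ->
  mat f (itin n x) (itin n y) (iter n s x) = ext0 f (x, y).
Proof.
move=> xy; rewrite /mat asboolT; last by split; [|rewrite xy]; exact: img_itin.
by rewrite {2}xy !pre_itin.
Qed.

Lemma mat_continuous n f (w w' : W n) : continuous f -> continuous (mat f w w').
Proof.
move=> cf t; rewrite /continuous_at.
have [[wt wt']|nt] := pselect (img w t /\ img w' t); last first.
  have nn : \forall u \near t, ~ (img w u /\ img w' u).
    have : open (~` (img w `&` img w')).
      by apply/closed_openC; apply: closedI; exact: closed_img.
    by rewrite openE; apply.
  have -> : mat f w w' t = 0 by rewrite /mat asboolF.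
  apply: cvg_near_cst; apply: filterS nn => u nu.
  by rewrite /mat asboolF.
have near_img : \forall u \near t, img w u /\ img w' u.
  by apply: filterI; apply: open_nbhs_nbhs; split => //; exact: open_img.
have Rpre u : img w u -> img w' u -> Rn s n (pre w u, pre w' u).
  by move=> /preP[_ wu] /preP[_ wu']; rewrite /Rn /= wu wu'.
have [p pE] := RunionP (Rn_Runion (Rpre _ wt wt')).
have -> : mat f w w' t = f p by rewrite /mat asboolT// -pE ext0_val.
move=> Q Qf; have : nbhs p (f @^-1` Q) by exact: (cf p _ Qf).
rewrite nbhsE => -[U [oU Up] UQ].
have [V oV UV] := oU n.
have Vt : V (pre w t, pre w' t) by rewrite -pE; apply/UV => //; rewrite pE; exact: Rpre.
have Vn : \forall u \near t, V (pre w u, pre w' u).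
  have : {for t, continuous (fun u => (pre w u, pre w' u))}.
    by apply: cvg_pair; exact: pre_continuous.
  by apply; apply: open_nbhs_nbhs.
suff: nbhs t (mat f w w' @^-1` Q) by [].
near=> u.
have [wu wu'] : img w u /\ img w' u by near: u.
rewrite /= /mat asboolT//.
have [p' p'E] := RunionP (Rn_Runion (Rpre _ wu wu')).
rewrite -p'E ext0_val; apply: UQ; apply/UV.
  by rewrite p'E; exact: Rpre.
by rewrite p'E; near: u.
Unshelve. all: by end_near. Qed.

(** Recovers a function of level [n] from its entries [mat]; membership in [Cc] thus reduces to
    continuity of scalar functions on [T]. *)
Definition of_mat n (M : W n -> W n -> T -> C) : Rel s -> C := fun p =>
  if `[< Rn s n (val p) >]
  then M (itin n (val p).1) (itin n (val p).2) (iter n s (val p).1) else 0.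

Lemma of_mat_level n (M : W n -> W n -> T -> C) : level n (of_mat M).
Proof. by apply: levelP => p np; rewrite /of_mat asboolF. Qed.

Lemma of_mat_continuous n (M : W n -> W n -> T -> C) :
  (forall w w', continuous (M w w')) -> continuous (of_mat M).
Proof.
move=> cM p; rewrite /continuous_at; have [oRn cRn] := clopen_Rn sL n.
have [np|np] := pselect (Rn s n (val p)); last first.
  apply: (@near_cst_continuous (Rel s) C 0).
  have : nbhs p (~` [set p : Rel s | Rn s n (val p)]).
    by apply: open_nbhs_nbhs; split=> //; exact: closed_openC.
  by move=> nn; apply: (@filterS _ (nbhs p) _ _ _ _ nn) => q /= nq; rewrite /of_mat asboolF.
have nn : nbhs p [set q : Rel s | Rn s n (val q)] by exact: open_nbhs_nbhs.
set w := itin n (val p).1; set w' := itin n (val p).2.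
have nw : \forall q \near p, itin n (val q).1 = w /\ itin n (val q).2 = w'.
  have := open_itin2 sL (P := fun v v' : W n => v = w /\ v' = w').
  move=> o; have H : nbhs (val p) [set q | itin n q.1 = w /\ itin n q.2 = w'].
    by apply: open_nbhs_nbhs; split.
  exact: (val_continuous H).
have cg : {for p, continuous (fun q : Rel s => M w w' (iter n s (val q).1))}.
  have c1 : {for p, continuous (fun q : Rel s => (val q).1)}.
    exact: (continuous_comp (@val_continuous p) (@cvg_fst _ _ _ _ _)).
  apply: (@continuous_comp _ _ _ (fun q : Rel s => (val q).1)
    (M w w' \o iter n s) p c1).
  apply: (@continuous_comp _ _ _ (iter n s) (M w w')); first exact: (iter_continuous sL).
  exact: cM.
apply: (near_eq_continuous _ cg).
have H : nbhs p (fun q => Rn s n (val q) /\ itin n (val q).1 = w /\ itin n (val q).2 = w').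
  exact: (@filterI _ (nbhs p) _ _ _ nn nw).
by apply: (@filterS _ (nbhs p) _ _ _ _ H) => q [nq [q1 q2]]; rewrite /of_mat asboolT// q1 q2.
Qed.

(** An open set of [Rel s] agrees on [Rn s n] with an open set of the product, so the cluster point
    of an ultrafilter found in the compact product also serves in [Rel s]. *)
Lemma compact_Rn n : compact [set p : Rel s | Rn s n (val p)].
Proof.
rewrite compact_ultra => F UF FRn.
have cT : compact [set: T * T].
  by rewrite -setXTT; apply: compact_setX; exact: (lc_compact sL).
have PF : ProperFilter F by exact: ultra_proper.
have [q [Rq qF]] : Rn s n `&` cluster (val @ F) !=set0.
  have cR := subclosed_compact (@closed_Rn _ _ _ _ sL n) cT (@subsetT _ _).
  exact: (cR _ (fmap_proper_filter _ PF) FRn). 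
have [p pq] := RunionP (Rn_Runion Rq).
exists p; split; first by rewrite /= pq.
move=> A; rewrite nbhsE => -[U [oU Up] UA].
have [V oV UV] := oU n.
have [/= FU|FU] := in_ultra_setVsetC U UF; first exact: filterS UA FU.
have FVn : F (val @^-1` ~` V).
  apply: (filterS _ (filterI FRn FU)) => r [/= rn rU] Vr; apply: rU; exact/(UV _ rn).
have Vq : nbhs q V.
  by apply: open_nbhs_nbhs; split => //; rewrite -pq; apply/UV => //; rewrite /= pq.
by have [r [Vr]] := qF _ _ FVn Vq.
Qed.

(** The clopen sets [Rn s n] increase to the whole relation, so a compact support lies in one of
    them; conversely a closed subset of the compact [Rn s n] is compact. *)
Lemma CcP f : Cc f <-> continuous f /\ exists n, level n f.
Proof.
split=> [[cf Kf]|[cf [n fn]]].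
  split=> //.
  have /compact_near_coveringP Knear := Kf.
  have := Knear nat \oo (fun n p => Rn s n (val p)) _.
  case.
    move=> p Kp; have [n _ np] := Rel_Runion p.
    have [oRn _] := clopen_Rn sL n.
    exists ([set p : Rel s | Rn s n (val p)], [set m | (n <= m)%N]).
      by split => /=; [exact: open_nbhs_nbhs|exists n].
    by move=> [q m] [/= qn nm]; exact: (Rn_le nm).
  move=> n _ Kn; exists n; apply: levelP => p; apply: contra_notP => /eqP fp.
  by apply: (Kn n) => /=; first exact: leqnn; exact: subset_closure.
split=> //; have [_ cRn] := clopen_Rn sL n.
apply: (@subclosed_compact _ _ [set p : Rel s | Rn s n (val p)]).
- exact: closed_closure.
- exact: compact_Rn.
move=> p Kp; rewrite (closure_id [set p : Rel s | Rn s n (val p)]).1//.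
apply: closure_subset Kp => q /=.
by apply: contra_neqP => nq; rewrite -ext0_val fn.
Qed.

End FiberMatrices.

(** * Continuity of conjugation, real part and the embedding of the reals *)

Section ComplexFunctions.
Context {R : realType}.
Local Notation C := R[i].

Lemma dist_continuous (K K' : numFieldType) (V : pseudoMetricNormedZmodType K)
    (V' : pseudoMetricNormedZmodType K') (f : V -> V') :
  (forall e, 0 < e -> exists2 d, 0 < d &
    forall x y, `|x - y| < d -> `|f x - f y| < e) -> continuous f.
Proof.
move=> fP x; apply/cvgrPdist_lt => e /fP[d d0 df]; near=> y.
apply: df; near: y.
by have /cvgrPdist_lt/(_ d d0) := (@cvg_id V (nbhs x)).
Unshelve. all: by end_near. Qed.

Lemma conj_continuous : continuous (fun z : C => z^*).
Proof.
apply: (@dist_continuous _ _ C C) => e e0; exists e => // x y.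
by rewrite -rmorphB norm_conjC.
Qed.

Lemma complex_gt0 (e : C) : 0 < e -> exists2 r : R, 0 < r & e = r%:C.
Proof.
case: e => a b; rewrite ltcE /= => /andP[b0 a0]; by exists a; rewrite ?(eqP b0).
Qed.

Lemma Re_continuous : continuous (fun z : C => complex.Re z).
Proof.
apply: (@dist_continuous _ _ C R) => e e0; exists e%:C; first by rewrite ltcR.
move=> x y xy; rewrite -raddfB /= -ltcR.
exact: le_lt_trans (normc_ge_Re _) xy.
Qed.

Lemma real_complex_continuous : continuous (fun x : R => x%:C : C).
Proof.
apply: (@dist_continuous _ _ R C) => e /complex_gt0[r r0 ->]; exists r => // x y.
by rewrite -rmorphB /= normc_def /= expr0n addr0 sqrtr_sqr ltcR.
Qed.

End ComplexFunctions.

(** * Convolution, adjoint, diagonal functions and compressions *)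

Section ConvolutionAlgebra.
Context (T : topologicalType) (s : T -> T) (k : nat) (L : T -> 'I_k).
Context (R : realType).
Hypothesis sL : labelled_covering s L.
Local Notation C := R[i].
Let W n := {ffun 'I_n -> 'I_k}.
Local Notation itin := (itin s L).
Local Notation mat := (mat L).
Local Notation of_mat := (of_mat (s := s) L).
Local Notation pre := (pre s L).
Local Notation img := (img s L).
Implicit Types (f g : Rel s -> C) (n : nat).

(** Each point of the [Rn s n]-class of [x] is [pre w] for its own itinerary [w]; this replaces the
    sum over a classical set by one over a finite type. *)
Lemma fiber_sum n x (F : T -> C) :
  (forall z, iter n s x <> iter n s z -> F z = 0) ->
  \sum_(z \in [set z | Runion s (x, z)]) F z =
  \sum_(w : W n) if `[< img w (iter n s x) >] then F (pre w (iter n s x)) else 0.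
Proof.
move=> F0; set t := iter n s x.
rewrite -(@fsbig_widen _ _ _ _ [set z | iter n s z = t]); last 2 first.
- by move=> z /= zt; exists n => //=; rewrite /Rn /= zt.
- by move=> z [_ /= zt] /=; apply: F0 => xz; apply: zt; rewrite -xz.
rewrite (@reindex_fsbig _ _ _ _ _ (fun w : W n => pre w t) [set w | img w t]); last first.
  split=> [w /preP[] //|w w' /set_mem wt /set_mem wt' ww'|z /= zt].
  - have [<- _] := preP wt; have [<- _] := preP wt'.
    by rewrite ww'.
  - exists (itin n z); first by rewrite -zt; exact: img_itin.
    by rewrite -zt pre_itin.
rewrite -big_mkcond /= (bigfs _ (P := fun w => `[< img w t >])) ?index_enum_uniq//.
  by apply: eq_fsbigl; apply/seteqP; split => w /= /asboolP.
by move=> w _; rewrite mem_index_enum.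
Qed.

Lemma convolE f g (p : Rel s) : convol f g p =
  \sum_(z \in [set z | Runion s ((val p).1, z)])
    ext0 f ((val p).1, z) * ext0 g (z, (val p).2).
Proof. by []. Qed.

Lemma eq_RelP f g :
  (forall x y, Runion s (x, y) -> ext0 f (x, y) = ext0 g (x, y)) -> f = g.
Proof.
move=> fg; apply/funext => p; have := Rel_Runion p.
by rewrite -!ext0_val; case: (val p) => x y; exact: fg.
Qed.

Lemma ext0_convol n f g x y : level n f -> level n g -> ext0 (convol f g) (x, y) =
  if `[< Rn s n (x, y) >] then
  \sum_(w : W n) if `[< img w (iter n s x) >]
    then ext0 f (x, pre w (iter n s x)) * ext0 g (pre w (iter n s x), y) else 0
  else 0.
Proof.
move=> fn gn; case: (asboolP (Rn s n (x, y))) => [xy|nxy].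
  have [p pE] := RunionP (Rn_Runion xy).
  rewrite -pE ext0_val convolE pE /= (@fiber_sum n)// => z xz.
  by rewrite fn ?mul0r.
have [/RunionP[p pE]|] := pselect (Runion s (x, y)); last exact: ext0_out.
rewrite -pE ext0_val convolE pE /=; apply: fsbig1 => z _.
have [xz|xz] := pselect (Rn s n (x, z)); last by rewrite fn ?mul0r.
by rewrite gn ?mulr0// => zy; apply: nxy; rewrite /Rn /= xz.
Qed.

Lemma convol_level n f g : level n f -> level n g -> level n (convol f g).
Proof. by move=> fn gn [x y] nxy; rewrite (ext0_convol _ _ fn gn) asboolF. Qed.

Lemma convol_of_mat n f g : level n f -> level n g ->
  convol f g = of_mat (fun w w' t => \sum_(v : W n) mat f w v t * mat g v w' t).
Proof.
move=> fn gn; apply/funext => p; rewrite -ext0_val /of_mat.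
case: (val p) => x y /=; rewrite (ext0_convol _ _ fn gn).
case: asboolP => // xy; apply: eq_bigr => v _.
rewrite /mat; case: (asboolP (img v _)) => vx; last first.
  by rewrite asboolF ?mul0r// => -[].
have xi := img_itin s L n x.
have yi : img (itin n y) (iter n s x) by rewrite xy; exact: img_itin.
have -> : pre (itin n x) (iter n s x) = x by exact: pre_itin.
have -> : pre (itin n y) (iter n s x) = y by rewrite xy pre_itin.
by rewrite !asboolT.
Qed.

Lemma Cc_of_mat n (M : W n -> W n -> T -> C) :
  (forall w w', continuous (M w w')) -> Cc (of_mat M).
Proof.
move=> cM; apply/(CcP sL); split; first exact: of_mat_continuous.
by exists n; exact: of_mat_level.
Qed.

Lemma Cc_level2 f g : Cc f -> Cc g ->
  exists n, level n f /\ level n g.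
Proof.
move=> /(CcP sL)[_ [n fn]] /(CcP sL)[_ [m gm]]; exists (maxn n m).
by split; [exact: level_le (leq_maxl n m) fn|exact: level_le (leq_maxr n m) gm].
Qed.

Lemma Cc_convol f g : Cc f -> Cc g -> Cc (convol f g).
Proof.
move=> Cf Cg; have [n [fn gn]] := Cc_level2 Cf Cg.
have [/(CcP sL)[cf _] /(CcP sL)[cg _]] := (Cf, Cg).
rewrite (convol_of_mat fn gn); apply: Cc_of_mat => w w'.
apply: (@continuous_big C _ +%R 0 xpredT _ T).
  exact: pseudometric_normed_Zmodule.add_continuous.
move=> v _ t; apply: (@cvgM C); exact: mat_continuous.
Qed.

Lemma ext0_adj f x y : ext0 (adj f) (x, y) = (ext0 f (y, x))^*.
Proof.
have [/RunionP[p pE]|nxy] := pselect (Runion s (x, y)).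
  by rewrite -pE ext0_val /adj pE.
by rewrite !ext0_out ?conjC0// => -[n _ yx]; apply: nxy; exists n => //; rewrite /Rn /= yx.
Qed.

Lemma adj_level n f : level n f -> level n (adj f).
Proof.
move=> fn [x y] nxy; rewrite ext0_adj fn ?conjC0// => yx; apply: nxy.
by rewrite /Rn /= yx.
Qed.

Lemma Cc_adj f : Cc f -> Cc (adj f).
Proof.
move=> /(CcP sL)[cf [n fn]].
suff -> : adj f = of_mat (fun w w' t => (mat f (w' : W n) w t)^*).
  apply: Cc_of_mat => w w' t.
  apply: (@continuous_comp _ _ _ (mat f w' w) (fun z : C => z^*)).
    exact: mat_continuous.
  exact: conj_continuous.
apply/funext => p; rewrite -ext0_val /of_mat.
case: asboolP => [|/(adj_level fn) //]; case: (val p) => x y xy /=.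
by rewrite ext0_adj xy matE.
Qed.

Lemma Cc_add f g : Cc f -> Cc g -> Cc (fun p => f p + g p).
Proof.
move=> Cf Cg; have [n [fn gn]] := Cc_level2 Cf Cg.
have [/(CcP sL)[cf _] /(CcP sL)[cg _]] := (Cf, Cg).
apply/(CcP sL); split; first by move=> p; exact: (continuousD (cf p) (cg p)).
exists n; apply: levelP => p np.
by rewrite -!ext0_val fn// gn// addr0.
Qed.

Lemma Cc_scale (a : C) f : Cc f -> Cc (fun p => a * f p).
Proof.
move=> /(CcP sL)[cf [n fn]]; apply/(CcP sL).
split.
  move=> p.
  exact: (@continuousM C _ (fun=> a) f p (@cst_continuous _ _ a p) (cf p)).
by exists n; apply: levelP => p np; rewrite -ext0_val fn// mulr0.
Qed.

Definition dg (u : T -> C) : Rel s -> C := fun p =>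
  if (val p).1 == (val p).2 then u (val p).1 else 0.

Lemma ext0_dg u x y : ext0 (dg u) (x, y) = if x == y then u x else 0.
Proof.
have [/RunionP[p pE]|nxy] := pselect (Runion s (x, y)).
  by rewrite -pE ext0_val /dg pE.
rewrite ext0_out//; case: eqP nxy => // -> []; by exists 0%N.
Qed.

Lemma dg_level n u : level n (dg u).
Proof.
by move=> [x y] nxy; rewrite ext0_dg; case: eqP nxy => // -> [].
Qed.

Lemma Cc_dg u : continuous u -> Cc (dg u).
Proof.
move=> cu; suff -> : dg u = of_mat (fun (w w' : W 0) t => u t).
  by apply: Cc_of_mat.
apply/funext => p; rewrite /dg /of_mat.
by case: asboolP => [/eqP -> //|/eqP/negbTE ->].
Qed.

Lemma Cc0 : Cc ((fun=> 0) : Rel s -> C).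
Proof.
suff -> : (fun=> 0) = dg (fun=> 0) by apply: Cc_dg; exact: cst_continuous.
by apply/funext => p; rewrite /dg if_same.
Qed.

Lemma ext0_convol_dgl u f x y : ext0 (convol (dg u) f) (x, y) = u x * ext0 f (x, y).
Proof.
have [/RunionP[p pE]|nxy] := pselect (Runion s (x, y)); last first.
  by rewrite !ext0_out ?mulr0.
rewrite -pE ext0_val convolE pE /= -(@fsbig_widen _ _ _ _ [set x]).
- by rewrite fsbig_set1 ext0_dg eqxx.
- by move=> _ ->; exists 0%N.
- by move=> z [_ /= zx]; rewrite ext0_dg; case: eqP zx => [->|_ _]; rewrite ?mul0r.
Qed.

Lemma ext0_convol_dgr u f x y : ext0 (convol f (dg u)) (x, y) = ext0 f (x, y) * u y.
Proof.
have [/RunionP[p pE]|nxy] := pselect (Runion s (x, y)); last first.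
  by rewrite !ext0_out ?mul0r.
rewrite -pE ext0_val convolE pE /= -(@fsbig_widen _ _ _ _ [set y]).
- by rewrite fsbig_set1 ext0_dg eqxx.
- by move=> _ -> /=; rewrite -pE; exact: Rel_Runion.
- by move=> z [_ /= zy]; rewrite ext0_dg; case: eqP zy => [->|_ _]; rewrite ?mulr0.
Qed.

Lemma convol_dg u v : convol (dg u) (dg v) = dg (fun x => u x * v x).
Proof.
apply: eq_RelP => x y _; rewrite ext0_convol_dgl !ext0_dg.
by case: eqP; rewrite ?mulr0.
Qed.

Lemma adj_dg u : adj (dg u) = dg (fun x => (u x)^*).
Proof.
apply: eq_RelP => x y _; rewrite ext0_adj !ext0_dg eq_sym.
by case: eqP => [->|]; rewrite ?conjC0.
Qed.

Lemma convol_dg1r f : convol f (dg (fun=> 1)) = f.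
Proof. by apply: eq_RelP => x y _; rewrite ext0_convol_dgr mulr1. Qed.

(** The restriction E of the overview, taken as a function on [T]. *)
Definition diag f (x : T) : C := ext0 f (x, x).

(** The diagonal is [Rn s 0], on which the inductive limit topology is that of [T * T]. *)
Lemma diag_continuous f : continuous f -> continuous (diag f).
Proof.
move=> cf; apply/continuousP => Q oQ.
have /continuousP/(_ _ oQ)/(_ 0%N)[V oV VQ] := cf.
suff -> : diag f @^-1` Q = (fun x => (x, x)) @^-1` V.
  apply: open_comp => // x _; exact: cvg_pair.
apply/seteqP; have H x : Rn s 0 (x, x) by [].
split=> x /=; have [p pE] := RunionP (Rn_Runion (H x)).
  by rewrite /diag -pE ext0_val => Qp; apply/VQ => //; rewrite pE.
by rewrite /diag -pE ext0_val => Vp; apply/VQ => //; rewrite pE.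
Qed.

Definition sel n (w : W n) (x : T) : C := (itin n x == w)%:R.

Lemma sel_continuous n (w : W n) : continuous (sel w).
Proof.
move=> x; apply: (@near_cst_continuous T C (sel w x)).
by apply: filterS (itin_near sL n x) => y; rewrite /sel => ->.
Qed.

(** Two points of one [Rn s n]-class with the same itinerary coincide. *)
Lemma compressE n f (w : W n) : level n f ->
  convol (dg (sel w)) (convol f (dg (sel w))) = dg (fun x => sel w x * diag f x).
Proof.
move=> fn; apply: eq_RelP => x y _.
rewrite ext0_convol_dgl ext0_convol_dgr ext0_dg /sel.
case: (eqVneq x y) => [<-|xy].
  by rewrite mulrCA -natrM mulnb andbb mulrC.
case: (eqVneq (itin n x) w) => [xw|]; last by rewrite mul0r.
case: (eqVneq (itin n y) w) => [yw|]; last by rewrite !mulr0.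
rewrite fn ?mul0r ?mulr0// => sxy; move/eqP: xy; apply.
by apply: (itin_inj sL (n := n)) => //; rewrite xw.
Qed.

(** The diagonal of f^* f at [x] is the sum of |f(z, x)|^2 over a finite class of [x], taken at a
    level where [f] is supported and which relates [y] to [x]; the left-hand side is one term of
    it. *)
Lemma diag_adj_convol_ge f x y : Cc f -> Runion s (y, x) ->
  `|ext0 f (y, x)| ^+ 2 <= diag (convol (adj f) f) x.
Proof.
move=> /(CcP sL)[_ [m fm]] [l _ yxl].
have fn := level_le (leq_maxl m l) fm.
have yx := Rn_le (leq_maxr m l) yxl; move: fn yx; set n := maxn m l => fn yx.
rewrite /diag (ext0_convol _ _ (adj_level fn) fn) asboolT//.
rewrite (bigD1 (itin n y))//= asboolT; last first.
  by rewrite /Rn /= in yx; rewrite -yx; exact: img_itin.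
have -> : pre (itin n y) (iter n s x) = y.
  by rewrite /Rn /= in yx; rewrite -yx pre_itin.
rewrite ext0_adj -normCKC lerDl; apply: sumr_ge0 => w _.
by case: ifP => // _; rewrite ext0_adj -normCKC exprn_ge0.
Qed.

End ConvolutionAlgebra.

(** * Ideals and norm estimates *)

Section RealNorm.
Context (R : realType) (A : cstarAlgebra R).
Local Notation C := R[i].
Implicit Types (a b c : A) (J S : set A).

(** Norms of [A] are nonnegative elements of [R[i]]; the real part takes them to a totally ordered
    field. *)
Definition nrm a : R := complex.Re `|a|.

Lemma nrmE a : `|a| = (nrm a)%:C.
Proof.
rewrite /nrm; have := normr_ge0 a; case: `|a| => x y.
by rewrite lecE /= => /andP[/eqP -> _].
Qed.

Lemma nrm_ge0 a : 0 <= nrm a.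
Proof. by rewrite -lecR -nrmE; exact: normr_ge0. Qed.

Lemma nrm0_eq0 a : nrm a = 0 -> a = 0.
Proof. by move=> a0; apply: normr0_eq0; rewrite nrmE a0. Qed.

Lemma nrm0 : nrm (0 : A) = 0.
Proof. by rewrite /nrm normr0. Qed.

Lemma nrmD a b : nrm (a + b) <= nrm a + nrm b.
Proof. by rewrite -lecR rmorphD /= -!nrmE; exact: ler_normD. Qed.

Lemma nrmN a : nrm (- a) = nrm a.
Proof. by rewrite /nrm normrN. Qed.

Lemma nrmM a b : nrm (cmul a b) <= nrm a * nrm b.
Proof. by rewrite -lecR rmorphM /= -!nrmE; exact: cnormM. Qed.

Lemma nrm_starM a : nrm (cmul (cstar a) a) = nrm a ^+ 2.
Proof.
apply: (fmorph_inj (real_complex R)).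
by rewrite rmorphXn /= -!nrmE; exact: cnorm_starM.
Qed.

Lemma nrm_le_star a : nrm a <= nrm (cstar a).
Proof.
have [->|a0] := eqVneq (nrm a) 0; first exact: nrm_ge0.
have ap : 0 < nrm a by rewrite lt_neqAle eq_sym a0 nrm_ge0.
by rewrite -(ler_pM2r ap) -expr2 -nrm_starM; exact: nrmM.
Qed.

Lemma nrm_star a : nrm (cstar a) = nrm a.
Proof.
by apply/eqP; rewrite eq_le nrm_le_star -{2}(cstarK a) nrm_le_star.
Qed.

Lemma nrmZ (r : R) a : 0 <= r -> nrm (r%:C *: a) = r * nrm a.
Proof.
move=> r0; apply: (fmorph_inj (real_complex R)).
by rewrite rmorphM /= -!nrmE normrZ ger0_norm ?lecR.
Qed.

Lemma cmulNr a b : cmul a (- b) = - cmul a b.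
Proof. by rewrite -scaleN1r cmulZr scaleN1r. Qed.

Lemma cmulNl a b : cmul (- a) b = - cmul a b.
Proof. by rewrite -scaleN1r cmulZl scaleN1r. Qed.

Lemma closureP S a :
  closure S a <-> forall e : R, 0 < e -> exists2 b, S b & nrm (a - b) < e.
Proof.
split=> [Sa e e0|Sa].
  have e0' : 0 < e%:C by rewrite ltcR.
  have [b [Sb]] := Sa _ (nbhsx_ballx a _ e0').
  by rewrite -ball_normE /= nrmE ltcR => ab; exists b.
move=> B /nbhs_ballP[e /complex_gt0[r r0 ->]] rB.
have [b Sb ab] := Sa r r0; exists b; split=> //; apply: rB.
by rewrite -ball_normE /= nrmE ltcR.
Qed.

(** Witnesses p(a) <= r for the quotient seminorm p of [J], without forming an infimum. *)
Definition within_dist J a (r : R) := exists2 j, J j & nrm (a - j) <= r.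

Section Ideal.
Context (J : set A).
Hypothesis cJ : closed_ideal J.

Lemma within_nrm a r : nrm a <= r -> within_dist J a r.
Proof. by move=> ar; exists 0; [exact: ideal0 cJ|rewrite subr0]. Qed.

Lemma within_ge0 a r : within_dist J a r -> 0 <= r.
Proof. by move=> [j _]; exact/le_trans/nrm_ge0. Qed.

Lemma withinM a b r q : within_dist J a r -> within_dist J b q ->
  within_dist J (cmul a b) (r * q).
Proof.
move=> [i Ji ai] [j Jj bj].
(* Chosen so that the difference from [cmul a b] factors as [cmul (a - i) (b - j)]. *)
exists (cmul a j + cmul i (b - j)).
  by apply: (idealD cJ); [exact: (idealMl cJ)|exact: (Defs.idealMr cJ)].
have -> : cmul a b - (cmul a j + cmul i (b - j)) = cmul (a - i) (b - j).
  by rewrite cmulDl cmulNl [in RHS]cmulDr cmulNr opprD addrA.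
by apply: le_trans (nrmM _ _) _; apply: ler_pM => //; exact: nrm_ge0.
Qed.

Lemma within_closed a : (forall e : R, 0 < e -> within_dist J a e) -> J a.
Proof.
move=> aJ; apply: (ideal_closed cJ); apply/closureP => e e0.
have [|j Jj aj] := aJ (e / 2); first by rewrite divr_gt0.
by exists j => //; apply: le_lt_trans aj _; lra.
Qed.

End Ideal.

(** For this ideal the distance estimates become estimates of the norm itself. *)
Lemma closed_ideal0 : closed_ideal ([set 0] : set A).
Proof.
split=> //.
- by apply: accessible_closed_set1; apply: hausdorff_accessible; exact: norm_hausdorff.
- by move=> a b -> ->; rewrite addr0.
- by move=> l a ->; rewrite scaler0.
- by move=> a b ->; rewrite -(scale0r (0 : A)) cmulZr !scale0r.
- by move=> a b ->; rewrite -(scale0r (0 : A)) cmulZl !scale0r.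
Qed.

End RealNorm.

Lemma expr_lt_eps (R : realType) (q e : R) : 0 <= q < 1 -> 0 < e ->
  exists n, q ^+ n < e.
Proof.
move=> /andP[q0 q1] e0.
have /cvgrPdist_lt/(_ e e0)[n _] : q ^+ n @[n --> \oo] --> (0 : R).
  by apply: cvg_expr; rewrite ger0_norm.
move/(_ n (leqnn n)); rewrite sub0r normrN ger0_norm ?exprn_ge0// => qe.
by exists n.
Qed.

(** A constant factor does not survive 2^k-th roots: if b < a, some power of b / a falls below 1 /
    (M + 1). *)
Lemma le_of_pow2_le (R : realType) (a b M : R) : 0 <= a -> 0 <= b -> 0 <= M ->
  (forall k, a ^+ (2 ^ k) <= M * b ^+ (2 ^ k)) -> a <= b.
Proof.
move=> a0 b0 M0 ab; rewrite leNgt; apply/negP => ba.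
have ap : 0 < a by exact: le_lt_trans ba.
have q01 : 0 <= b / a < 1 by rewrite divr_ge0//= ltr_pdivrMr ?mul1r.
have e0 : 0 < (M + 1)^-1 by rewrite invr_gt0; lra.
have [n qn] := expr_lt_eps q01 e0.
have := ab n; apply/negP; rewrite -ltNge.
have q2n : (b / a) ^+ (2 ^ n) < (M + 1)^-1.
  apply: le_lt_trans qn; case/andP: q01 => q0 q1.
  by apply: ler_wiXn2l => //; [exact: ltW|exact/ltnW/ltn_expl].
have -> : b ^+ (2 ^ n) = (b / a) ^+ (2 ^ n) * a ^+ (2 ^ n).
  by rewrite -exprMn divfK// gt_eqF.
rewrite mulrA gtr_pMl ?exprn_gt0//.
have [->|M0'] := eqVneq M 0; first by rewrite mul0r.
have Mp : 0 < M by rewrite lt_neqAle eq_sym M0'.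
apply: (@lt_trans _ _ (M * (M + 1)^-1)); first by rewrite ltr_pM2l.
by rewrite ltr_pdivrMr; lra.
Qed.

(** * Norms of real diagonal functions *)

Section NormEstimates.
Context (T : topologicalType) (s : T -> T) (k : nat) (L : T -> 'I_k).
Context (R : realType) (A : cstarAlgebra R).
Context (N : (Rel s -> R[i]) -> R[i]) (iota : (Rel s -> R[i]) -> A).
Hypotheses (sL : labelled_covering s L) (ci : completion N iota).
Local Notation C := R[i].
Local Notation dg := (dg (s := s)).
Implicit Types (f g : Rel s -> C) (u v : T -> R) (J : set A).

Definition rdg u : Rel s -> C := dg (fun x => (u x)%:C).

Lemma Cc_rdg u : continuous u -> Cc (rdg u).
Proof.
move=> cu; apply: (Cc_dg sL) => x.
apply: (@continuous_comp _ _ _ u (real_complex R)); first exact: cu.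
exact: real_complex_continuous.
Qed.

Lemma iota0 : iota (fun=> 0) = 0.
Proof.
have := completionZ ci 0 (Cc0 R sL); rewrite scale0r => <-; congr iota.
by apply/funext => p; rewrite mul0r.
Qed.

Lemma iota_sum (I : Type) (r : seq I) (F : I -> Rel s -> C) :
  (forall i, Cc (F i)) ->
  Cc (fun p => \sum_(i <- r) F i p) /\
  iota (fun p => \sum_(i <- r) F i p) = \sum_(i <- r) iota (F i).
Proof.
move=> CF; elim: r => [|i r [Cr ir]].
  under eq_fun do rewrite big_nil; rewrite big_nil iota0.
  by split=> //; exact: (Cc0 R sL).
under eq_fun do rewrite big_cons; rewrite big_cons -ir (completionD ci)//.
by split => //; exact: (Cc_add sL).
Qed.

(** The unit is a self-adjoint idempotent, so its norm x satisfies x = x^2. *)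
Lemma nrm_iota1 : nrm (iota (rdg (fun=> 1))) <= 1.
Proof.
have C1 : Cc (rdg (fun=> 1)) by apply: Cc_rdg; exact: cst_continuous.
have := nrm_starM (iota (rdg (fun=> 1))).
rewrite -(completion_star ci)// -(completionM ci)//; last exact: (Cc_adj sL).
rewrite {1 2}/rdg adj_dg (convol_dg s).
have -> : (fun x : T => (1%:C : C)^* * 1%:C) = (fun=> 1%:C).
  by apply/funext => x; rewrite conjC1 mulr1.
rewrite -/(rdg (fun=> 1)); move: (nrm _) (nrm_ge0 (iota (rdg (fun=> 1)))) => x x0.
move=> xx; rewrite leNgt; apply/negP => x1.
by have := ltr_pM2l (lt_trans ltr01 x1) 1 x; rewrite mulr1 -expr2 -xx x1 ltxx.
Qed.

(* [2 u] is the sum of the conjugate elements [u + i sqrt (c^2 - u^2)] and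
   [u - i sqrt (c^2 - u^2)], which are [c] times unitaries. *)
Lemma nrm_rdg_le u (c : R) : continuous u -> 0 <= c -> (forall x, `|u x| <= c) ->
  nrm (iota (rdg u)) <= c.
Proof.
move=> cu c0 uc.
have uc2 x : u x ^+ 2 <= c ^+ 2 by rewrite -real_normK ?num_real// ler_pXn2r ?nnegrE.
pose v (x : T) : C := (u x +i* Num.sqrt (c ^+ 2 - u x ^+ 2))%C.
have cv : continuous v.
  have -> : v = (fun x => (u x)%:C + 'i * (Num.sqrt (c ^+ 2 - u x ^+ 2))%:C).
    by apply/funext => x; rewrite -complexiE /v; simpc.
  move=> x; apply: (@cvgD _ C).
    apply: (@continuous_comp _ _ _ u (real_complex R)); first exact: cu.
    exact: real_complex_continuous.
  apply: (@cvgM C); first exact: (@cvg_cst C).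
  apply: (@continuous_comp _ _ _ (fun x => c ^+ 2 - u x ^+ 2)
     (fun x => (Num.sqrt x)%:C : C)).
    apply: cvgB; first exact: cvg_cst.
    by rewrite expr2; apply: cvgM; exact: cu.
  apply: (@continuous_comp _ _ _ Num.sqrt (real_complex R)).
    exact: sqrt_continuous.
  exact: real_complex_continuous.
have Cv : Cc (dg v) by exact: (Cc_dg sL).
have Cv' : Cc (adj (dg v)) by exact: (Cc_adj sL).
have C1 : Cc (rdg (fun=> 1)) by apply: Cc_rdg; exact: cst_continuous.
have vv : cmul (cstar (iota (dg v))) (iota (dg v)) = (c ^+ 2)%:C *: iota (rdg (fun=> 1)).
  rewrite -(completion_star ci)// -(completionM ci)// -(completionZ ci)//; congr iota.
  rewrite adj_dg convol_dg; apply: eq_RelP => x y xy.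
  have [p pE] := RunionP xy; rewrite -pE !ext0_val /dg /rdg /dg.
  case: ifP => _; last by rewrite mulr0.
  rewrite mulr1 /v; apply/eqP; rewrite eq_complex /=; apply/andP; split; apply/eqP; last ring.
  rewrite mulNr opprK -!expr2 sqr_sqrtr ?subr_ge0//; ring.
have nv : nrm (iota (dg v)) <= c.
  rewrite -(@ler_pXn2r _ 2)// ?nnegrE ?nrm_ge0// -nrm_starM vv nrmZ ?sqr_ge0//.
  by rewrite ler_piMr ?sqr_ge0// nrm_iota1.
have uv : 2%:C *: iota (rdg u) = iota (dg v) + cstar (iota (dg v)).
  rewrite -(completion_star ci)// -(completionD ci)// -(completionZ ci)//; last exact: Cc_rdg.
  congr iota; apply: eq_RelP => x y xy.
  have [p pE] := RunionP xy; rewrite -pE adj_dg !ext0_val /rdg /dg.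
  case: ifP => _; last by rewrite mulr0 addr0.
  by rewrite /v; apply/eqP; rewrite eq_complex /=; apply/andP; split; apply/eqP; ring.
have : 2 * nrm (iota (rdg u)) <= c + c.
  rewrite -nrmZ// uv; apply: le_trans (nrmD _ _) _; rewrite nrm_star.
  exact: lerD.
lra.
Qed.

End NormEstimates.

(** * Ideals without positive diagonal functions *)

Section Simplicity.
Context (T : topologicalType) (s : T -> T) (k : nat) (L : T -> 'I_k).
Context (R : realType) (A : cstarAlgebra R).
Context (N : (Rel s -> R[i]) -> R[i]) (iota : (Rel s -> R[i]) -> A).
Hypotheses (sL : labelled_covering s L) (ci : completion N iota).
Local Notation C := R[i].
Let W n := {ffun 'I_n -> 'I_k}.
Local Notation itin := (itin s L).
Local Notation dg := (dg (s := s)).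
Local Notation rdg := (rdg (s := s)).
Local Notation sel := (sel s L R).
Implicit Types (f g : Rel s -> C) (u v : T -> R) (J : set A).

Lemma real_ge0 (z : C) : 0 <= z -> z = (complex.Re z)%:C /\ 0 <= complex.Re z.
Proof. by case: z => x y; rewrite lecE /= => /andP[/eqP -> ->]. Qed.

Lemma nrm_dg_le (w : T -> C) (c : R) : continuous w -> 0 <= c ->
  (forall x, 0 <= w x <= c%:C) -> nrm (iota (dg w)) <= c.
Proof.
move=> cw c0 wc; have wE x : w x = (complex.Re (w x))%:C /\ 0 <= complex.Re (w x).
  by apply: real_ge0; case/andP: (wc x).
have -> : dg w = rdg (fun x => complex.Re (w x)).
  by congr dg; apply/funext => x; case: (wE x).
apply: (nrm_rdg_le sL ci) => // [x|x].
  apply: (@continuous_comp _ _ _ w (fun z : C => complex.Re z)); first exact: cw.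
  exact: Re_continuous.
have [wx w0] := wE x; rewrite ger0_norm// -lecR -wx.
by case/andP: (wc x).
Qed.

Definition no_positive_diag J := forall b : T -> R, continuous b ->
  (forall x, 0 <= b x) -> J (iota (rdg b)) -> forall x, b x = 0.

Section Ideal.
Context (J : set A).
Hypothesis (cJ : closed_ideal J).

(* If [r < r' < g x], then [b = min 1 (max 0 (g - r'))] factors as [g^n u_n] with
   [u_n <= r'^-n], whence [b] is at distance [(r / r')^n] from [J]. *)
Lemma within_diag_le (g : T -> R) (r : R) : no_positive_diag J -> continuous g ->
  (forall x, 0 <= g x) -> within_dist J (iota (rdg g)) r -> forall x, g x <= r.
Proof.
move=> nJ cg g0 gr x; rewrite leNgt; apply/negP => rg.
have r0 := within_ge0 gr.
pose r' := (r + g x) / 2; have rr' : r < r' by rewrite /r'; lra.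
have r'0 : 0 < r' by exact: le_lt_trans rr'.
pose b y := Num.min 1 (Num.max 0 (g y - r')).
pose m y := Num.max (g y) r'.
have m0 y : 0 < m y by rewrite lt_max r'0 orbT.
pose u n y := b y / m y ^+ n.
have cb : continuous b.
  move=> y; apply: (@continuous_min _ _ (fun=> 1) (fun y => Num.max 0 (g y - r'))).
    exact: cvg_cst.
  apply: (@continuous_max _ _ (fun=> 0) (fun y => g y - r')); first exact: cvg_cst.
  by apply: cvgB; [exact: cg|exact: cvg_cst].
have cm : continuous m.
  by move=> y; apply: (@continuous_max _ _ g (fun=> r')); [exact: cg|exact: cvg_cst].
have cu n : continuous (u n).
  move=> y; apply: cvgM; first exact: cb.
  apply: cvgV; first by rewrite expf_neq0// gt_eqF.
  apply: (@continuous_comp _ _ _ m (fun z => z ^+ n)); first exact: cm.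
  exact: exprn_continuous.
have b0 y : 0 <= b y by rewrite /b le_min ler01 le_max lexx.
have b1 y : b y <= 1 by rewrite /b ge_min lexx.
have uS n y : u n y = g y * u n.+1 y.
  rewrite /u; have [gr'|gr'] := leP (g y) r'.
    have -> : b y = 0 by rewrite /b max_l ?subr_le0// min_r// ler01.
    by rewrite !mul0r mulr0.
  have -> : m y = g y by rewrite /m max_l// ltW.
  rewrite exprS; field.
  have g0' : g y != 0 by rewrite gt_eqF// (lt_trans r'0).
  by rewrite expf_neq0.
have within_u n i : within_dist J (iota (rdg (u i)))
    (r ^+ n * nrm (iota (rdg (u (i + n)%N)))).
  elim: n i => [|n ih] i; first by rewrite expr0 mul1r addn0; exact: within_nrm.
  have -> : iota (rdg (u i)) = cmul (iota (rdg g)) (iota (rdg (u i.+1))).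
    rewrite -(completionM ci); try exact: (Cc_rdg sL).
    congr iota.
    rewrite convol_dg; congr dg; apply/funext => y.
    by rewrite (uS i) rmorphM.
  by rewrite exprS -mulrA addnS -addSn; apply: withinM.
have nu n : nrm (iota (rdg (u n))) <= (r' ^+ n)^-1.
  apply: (nrm_rdg_le sL ci) => // [|y].
    by rewrite invr_ge0 exprn_ge0// ltW.
  rewrite ger0_norm; last by rewrite divr_ge0// exprn_ge0// ltW.
  rewrite -[leRHS]mul1r ler_pM ?invr_ge0 ?exprn_ge0 ?(ltW (m0 y))//.
  rewrite lef_pV2 ?posrE ?exprn_gt0//.
  by rewrite lerXn2r ?nnegrE ?(ltW (m0 y)) ?(ltW r'0)// /m le_max lexx orbT.
have Jb : J (iota (rdg b)).
  have -> : b = u 0%N by apply/funext => y; rewrite /u expr0 divr1.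
  apply: (within_closed cJ) => e e0.
  have q01 : 0 <= r / r' < 1.
    by rewrite divr_ge0 ?(ltW r'0)//= ltr_pdivrMr ?mul1r.
  have [n qn] := expr_lt_eps q01 e0.
  have [j Jj uj] := within_u n 0%N; exists j => //.
  apply: le_trans uj _; apply: le_trans (ltW qn).
  by rewrite expr_div_n ler_wpM2l ?exprn_ge0.
have := nJ b cb b0 Jb x; rewrite /b => /eqP; apply/negP.
by rewrite gt_eqF// lt_min ltr01 lt_max subr_gt0 (_ : r' < g x) ?orbT// /r'; lra.
Qed.

Lemma sel_real n (w : W n) x : sel w x = ((itin n x == w)%:R : R)%:C.
Proof. by rewrite /sel; case: eqP. Qed.

Lemma nrm_sel n (w : W n) : nrm (iota (dg (sel w))) <= 1.
Proof.
apply: nrm_dg_le => //; first exact: (sel_continuous sL).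
move=> x; rewrite sel_real !lecR.
by case: eqP; rewrite ?lexx ler01.
Qed.

Lemma Cc_sel n (w : W n) : Cc (dg (sel w)).
Proof. by apply: (Cc_dg sL); exact: (sel_continuous sL). Qed.

Lemma Cc_compress n (w : W n) f : Cc f -> Cc (convol (dg (sel w)) (convol f (dg (sel w)))).
Proof. by move=> Cf; do ![apply: (Cc_convol sL) => //; try exact: Cc_sel]. Qed.

Lemma iota_compress n (w : W n) f : Cc f ->
  iota (convol (dg (sel w)) (convol f (dg (sel w)))) =
  cmul (iota (dg (sel w))) (cmul (iota f) (iota (dg (sel w)))).
Proof.
move=> Cf; rewrite !(completionM ci)//; try exact: Cc_sel.
by apply: (Cc_convol sL) => //; exact: Cc_sel.
Qed.

Lemma sel_diag_continuous n (w : W n) f : Cc f ->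
  continuous (fun x => sel w x * diag f x).
Proof.
move=> /(CcP sL)[cf _] x; apply: (@cvgM C); first exact: (sel_continuous sL).
exact: diag_continuous.
Qed.

(** The compression of [f] by the itinerary of [x] is diagonal, keeps the value at [x], and is no
    farther from [J] than [f], since the projection has norm at most 1. *)
Lemma within_diag_Cc f (r : R) : no_positive_diag J -> Cc f ->
  (forall x, 0 <= diag f x) -> within_dist J (iota f) r ->
  forall x, complex.Re (diag f x) <= r.
Proof.
move=> nJ Cf f0 fr x; have [_ [n fn]] := (CcP sL f).1 Cf.
pose w := itin n x.
pose g y := complex.Re (sel w y * diag f y).
have gE y : sel w y * diag f y = (g y)%:C /\ 0 <= g y.
  by apply: real_ge0; rewrite mulr_ge0// /sel ler0n.
have -> : complex.Re (diag f x) = g x by rewrite /g /sel eqxx mul1r.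
apply: within_diag_le => // [y|y|].
- apply: (@continuous_comp _ _ _ (fun y => sel w y * diag f y) (fun z : C => complex.Re z)).
    exact: sel_diag_continuous.
  exact: Re_continuous.
- by case: (gE y).
have -> : rdg g = dg (fun y => sel w y * diag f y).
  by congr dg; apply/funext => y; case: (gE y).
rewrite -compressE// iota_compress//.
rewrite -[r]mulr1 -[r * 1]mul1r.
by do ![apply: withinM => //]; apply: within_nrm => //; exact: nrm_sel.
Qed.

(* [f] is the sum over the itineraries [w] of the [f e_w], with [e_w = dg (sel w)],
   where [(f e_w)^* (f e_w)] is the diagonal function [e_w E(f^* f)]. *)
Lemma nrm_iota_diag_le n f (c : R) : Cc f -> level n f -> 0 <= c ->
  (forall x, complex.Re (diag (convol (adj f) f) x) <= c ^+ 2) ->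
  nrm (iota f) <= #|W n|%:R * c.
Proof.
move=> Cf fn c0 fc.
have Cff : Cc (convol (adj f) f) by apply: (Cc_convol sL) => //; exact: (Cc_adj sL).
have Cfw (w : W n) : Cc (convol f (dg (sel w))).
  by apply: (Cc_convol sL) => //; exact: Cc_sel.
have [_ sumE] := iota_sum sL ci (index_enum (W n)) Cfw.
have -> : f = (fun p => \sum_(w : W n) convol f (dg (sel w)) p).
  apply/funext => p; rewrite -ext0_val.
  under eq_bigr do rewrite -ext0_val.
  case: (val p) => x y; under eq_bigr do rewrite ext0_convol_dgr.
  rewrite -mulr_sumr (bigD1 (itin n y))//= big1 => [|w wy].
    by rewrite /sel eqxx addr0 mulr1.
  by rewrite /sel eq_sym (negbTE wy).
rewrite sumE.
have le_w (w : W n) : nrm (iota (convol f (dg (sel w)))) <= c.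
  rewrite -(@ler_pXn2r _ 2)// ?nnegrE ?nrm_ge0// -nrm_starM.
  have -> : cmul (cstar (iota (convol f (dg (sel w))))) (iota (convol f (dg (sel w)))) =
      iota (convol (dg (sel w)) (convol (convol (adj f) f) (dg (sel w)))).
    rewrite iota_compress// (completionM ci)//; last exact: Cc_sel.
    rewrite (completionM ci)//; last exact: (Cc_adj sL).
    rewrite cstarM (completion_star ci)// -(completion_star ci (Cc_sel _)) adj_dg.
    have -> : (fun x => (sel w x)^*) = sel w.
      by apply/funext => x; rewrite /sel conjC_nat.
    by rewrite !cmulA.
  rewrite (compressE sL); last by apply: (convol_level sL) => //; exact: adj_level.
  apply: nrm_dg_le; [exact: sel_diag_continuous|exact: sqr_ge0|].
  move=> x; have := diag_adj_convol_ge sL (x := x) (y := x) Cf.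
  move=> /(_ (ex_intro2 _ _ 0%N I erefl)) dx.
  have /real_ge0[-> d0] : 0 <= diag (convol (adj f) f) x.
    by apply: le_trans dx; rewrite exprn_ge0.
  rewrite sel_real -rmorphM !lecR.
  case: eqP => _; first by rewrite mul1r d0 fc.
  by rewrite mul0r lexx sqr_ge0.
rewrite -sum1_card natr_sum mulr_suml.
elim/big_ind2: _ => [|a x b y ax By|w _].
- by rewrite nrm0.
- by apply: le_trans (nrmD _ _) _; exact: lerD.
- by rewrite mul1r.
Qed.

(** With q = f^* f, the term of index i maps to q^(2^i) in [A], by self-adjointness; written as a
    product g^* g, it has its norm squared exactly at each step. *)
Fixpoint star_powers f i := if i is j.+1
  then convol (adj (star_powers f j)) (star_powers f j) else convol (adj f) f.

Lemma star_powersP n f i : Cc f -> level n f ->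
  [/\ Cc (star_powers f i), level n (star_powers f i) &
      cstar (iota (star_powers f i)) = iota (star_powers f i)].
Proof.
have H g : Cc g -> level n g -> [/\ Cc (convol (adj g) g),
    level n (convol (adj g) g) &
    cstar (iota (convol (adj g) g)) = iota (convol (adj g) g)].
  move=> Cg gn; split.
  - by apply: (Cc_convol sL) => //; exact: (Cc_adj sL).
  - by apply: (convol_level sL) => //; exact: adj_level.
  rewrite (completionM ci)//; last exact: (Cc_adj sL).
  by rewrite cstarM (completion_star ci)// cstarK.
by move=> Cf fn; elim: i => [|i [Ci ni _]]; apply: H.
Qed.

(* For [q = f^* f], [|q|^(2^i) = |q^(2^i)|] is at most [#|W n|] times the square
   root of the bound of [within_diag_Cc] on the diagonal of [q^(2^(i+1))], where [n]
   does not depend on [i]. Taking roots removes the factor [#|W n|]. *)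
Lemma nrm_le_within f (r : R) : no_positive_diag J -> Cc f ->
  within_dist J (iota f) r -> nrm (iota f) <= r.
Proof.
move=> nJ Cf fr; have [_ [n fn]] := (CcP sL f).1 Cf.
pose q i := star_powers f i.
have qP i : [/\ Cc (q i), level n (q i) & cstar (iota (q i)) = iota (q i)].
  exact: star_powersP.
have Cadj g : Cc g -> Cc (adj g) by exact: (Cc_adj sL).
have r0 := within_ge0 fr.
(* Since [J] need not be closed under the adjoint, f^* is bounded by its norm and only f by its
   distance to [J]. The extra factor |f| cancels at the end, from |f|^2 <= |f| r. *)
pose c := nrm (iota f) * r.
have c0 : 0 <= c by rewrite mulr_ge0// nrm_ge0.
have q0 : iota (q 0%N) = cmul (cstar (iota f)) (iota f).
  by rewrite (completionM ci) ?(completion_star ci)//; exact: Cadj.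
have qS i : iota (q i.+1) = cmul (cstar (iota (q i))) (iota (q i)).
  have [Ci _ _] := qP i.
  rewrite [q i.+1]/(convol (adj (q i)) (q i)) (completionM ci) //; last exact: Cadj.
  by rewrite (completion_star ci).
have within_q i : within_dist J (iota (q i)) (c ^+ (2 ^ i)).
  elim: i => [|i ih].
    rewrite q0 expr1; apply: withinM => //.
    by apply: within_nrm => //; rewrite nrm_star.
  have [_ _ sa] := qP i.
  by rewrite qS sa expnS mulnC exprM expr2; exact: withinM.
have nrm_q i : nrm (iota (q i)) = nrm (iota (q 0%N)) ^+ (2 ^ i).
  by elim: i => // i ih; rewrite qS nrm_starM ih expnS mulnC exprM.
have : nrm (iota (q 0%N)) <= c.
  apply: (@le_of_pow2_le _ _ _ #|W n|%:R) => //; first exact: nrm_ge0.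
  move=> i; rewrite -nrm_q; have [Ci ni _] := qP i.
  apply: nrm_iota_diag_le => //; first exact: exprn_ge0.
  have [Ci1 _ _] := qP i.+1.
  rewrite -exprM mulnC -expnS; apply: within_diag_Cc (within_q i.+1) => // x.
  have := diag_adj_convol_ge sL (x := x) (y := x) Ci.
  move=> /(_ (ex_intro2 _ _ 0%N I erefl)); apply: le_trans.
  by rewrite exprn_ge0.
rewrite q0 nrm_starM /c expr2.
have [->|n0] := eqVneq (nrm (iota f)) 0; first by move=> _.
by rewrite ler_pM2l// lt_neqAle eq_sym n0 nrm_ge0.
Qed.

(** The isometry estimate is available on [Cc] only; an element of [Cc] approximating a member of
    [J] is close to [J], hence small. *)
Lemma no_positive_diag_ideal0 : no_positive_diag J -> J = [set 0].
Proof.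
move=> nJ; apply/seteqP; split=> [a Ja /=|_ ->]; last exact: (ideal0 cJ).
apply: nrm0_eq0; apply/eqP; rewrite eq_le nrm_ge0 andbT.
apply/ler_addgt0Pr => e e0; rewrite add0r.
have : closure (iota @` @Cc T R s) a by rewrite (completion_dense ci).
move=> /closureP/(_ (e / 2))[|_ [f Cf <-] af]; first by rewrite divr_gt0.
have : nrm (iota f) <= e / 2.
  apply: nrm_le_within => //; exists a => //.
  by rewrite -nrmN opprB ltW.
have := nrmD (a - iota f) (iota f); rewrite subrK; lra.
Qed.

End Ideal.

End Simplicity.

(** * Simplicity of the algebra and exactness of the covering *)

Section SimpleExact.
Context (T : topologicalType) (s : T -> T) (k : nat) (L : T -> 'I_k).
Context (R : realType) (A : cstarAlgebra R).
Context (N : (Rel s -> R[i]) -> R[i]) (iota : (Rel s -> R[i]) -> A).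
Hypotheses (sL : labelled_covering s L) (cN : cstar_norm N).
Hypothesis (ci : completion N iota).
Local Notation C := R[i].
Let W n := {ffun 'I_n -> 'I_k}.
Local Notation itin := (itin s L).
Local Notation pre := (pre s L).
Local Notation dg := (dg (s := s)).
Local Notation rdg := (rdg (s := s)).
Local Notation sel := (sel s L R).
Implicit Types (f g : Rel s -> C) (u v b : T -> R) (J : set A).

Lemma iota_inj0 f : Cc f -> iota f = 0 -> f = (fun=> 0).
Proof.
move=> Cf f0; apply: (cstar_norm_eq0 cN) => //.
by rewrite -(completion_norm ci)// f0 normr0.
Qed.

Lemma rdg_eq0 b : rdg b = (fun=> 0) -> forall x, b x = 0.
Proof.
move=> b0 x; have [|p pE] := @RunionP _ s (x, x); first by exists 0%N.
have := congr1 (fun f => f p) b0; rewrite /rdg /dg pE /= eqxx.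
exact: (fmorph_inj (real_complex R)).
Qed.

Lemma no_positive_diag0 : no_positive_diag iota [set 0].
Proof. by move=> b cb b0 /(iota_inj0 (Cc_rdg sL cb))/rdg_eq0. Qed.

(** For the zero ideal the diagonal estimate bounds E(f^* f) by r^2, and |E f|^2 <= E(f^* f). *)
Lemma nrm_iota_ge f (r : R) x : Cc f -> nrm (iota f) <= r ->
  `|diag f x| <= r%:C.
Proof.
move=> Cf fr; have r0 : 0 <= r by exact: le_trans (nrm_ge0 _) fr.
have Cff : Cc (convol (adj f) f) by apply: (Cc_convol sL) => //; exact: (Cc_adj sL).
have dfge y := diag_adj_convol_ge sL (x := y) (y := y) Cf (ex_intro2 _ _ 0%N I erefl).
have df0 y : 0 <= diag (convol (adj f) f) y.
  by apply: le_trans (dfge y); rewrite exprn_ge0.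
have ffr : within_dist [set 0] (iota (convol (adj f) f)) (r ^+ 2).
  apply: (within_nrm (@closed_ideal0 R A)).
  rewrite (completionM ci)//; last exact: (Cc_adj sL).
  by rewrite (completion_star ci)// nrm_starM lerXn2r ?nnegrE ?nrm_ge0.
have := within_diag_Cc sL ci (@closed_ideal0 R A) no_positive_diag0 Cff df0 ffr x.
rewrite -lecR -(real_ge0 (df0 x)).1 => /(le_trans (dfge x)).
by rewrite rmorphXn ler_pXn2r// nnegrE lecR.
Qed.

Definition unit_rel n : Rel s -> C := of_mat L (fun (w w' : W n) (t : T) => 1).

Lemma ext0_unit_rel n x y :
  ext0 (unit_rel n) (x, y) = if `[< Rn s n (x, y) >] then 1 else 0.
Proof.
case: (asboolP (Rn s n (x, y))) => [xy|]; last exact: of_mat_level.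
by have [p pE] := RunionP (Rn_Runion xy); rewrite -pE ext0_val /unit_rel /of_mat pE asboolT.
Qed.

Lemma Cc_unit_rel n : Cc (unit_rel n).
Proof. by apply: (Cc_of_mat sL) => w w'; exact: cst_continuous. Qed.

(* [sum_w e_w xi b xi e_w], with [xi] the indicator function of [R_n], is the
   diagonal function [x |-> sum of b over the R_n-class of x]. *)
Lemma ideal_full J b : closed_ideal J -> continuous b -> (forall x, 0 <= b x) ->
  J (iota (rdg b)) -> (exists n, iter n s @` [set x | 0 < b x] = setT) -> J = setT.
Proof.
move=> cJ cb b0 Jb [n bn].
pose h := convol (unit_rel n) (convol (rdg b) (unit_rel n)).
have Cb := Cc_rdg sL cb.
have Ch : Cc h.
  by do ![apply: (Cc_convol sL) => //; try exact: Cc_unit_rel].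
have hn : level n h.
  apply: (convol_level sL); first exact: of_mat_level.
  by apply: (convol_level sL); [exact: dg_level|exact: of_mat_level].
have Jh : J (iota h).
  rewrite /h (completionM ci); [|exact: Cc_unit_rel|].
    apply: (idealMl cJ); rewrite (completionM ci)//; last exact: Cc_unit_rel.
    exact: (Defs.idealMr cJ).
  by apply: (Cc_convol sL) => //; exact: Cc_unit_rel.
have hpos y : 0 < diag h y.
  (* The class of [y] meets the set where [b] is positive, and one positive term suffices, the
     others being nonnegative. *)
  have [z bz sz] : (iter n s @` [set x | 0 < b x]) (iter n s y) by rewrite bn.
  rewrite /diag /h (ext0_convol sL (n := n)); last 2 first.
  - exact: of_mat_level.
  - by apply: (convol_level sL); [exact: dg_level|exact: of_mat_level].
  rewrite asboolT// (bigD1 (itin n z))//= asboolT; last by rewrite -sz; exact: img_itin.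
  have -> : pre (itin n z) (iter n s y) = z by rewrite -sz pre_itin.
  rewrite ext0_convol_dgl !ext0_unit_rel !asboolT// mul1r mulr1.
  rewrite ltr_pwDl ?ltcR//; apply: sumr_ge0 => w _; case: ifP => // _.
  rewrite ext0_convol_dgl !ext0_unit_rel; case: ifP; rewrite ?mul0r// mul1r.
  by case: ifP; rewrite ?mulr0// mulr1 lecR.
have JB : J (iota (dg (diag h))).
  have Ce (w : W n) : Cc (convol (dg (sel w)) (convol h (dg (sel w)))).
    exact: Cc_compress.
  have [_ sumE] := iota_sum sL ci (index_enum (W n)) Ce.
  have -> : dg (diag h) = (fun p => \sum_(w : W n) convol (dg (sel w)) (convol h (dg (sel w))) p).
    apply/funext => p; under eq_bigr do rewrite (compressE sL)//.
    rewrite /dg; case: ifP => _; last by rewrite big1.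
    rewrite -mulr_suml (bigD1 (itin n (val p).1))//= big1 => [|w wy].
      by rewrite /sel eqxx addr0 mul1r.
    by rewrite /sel eq_sym (negbTE wy).
  rewrite sumE; elim/big_ind: _ => [|a c Ja Jc|w _].
  - exact: (ideal0 cJ).
  - exact: (idealD cJ).
  rewrite (iota_compress sL ci)//; apply: (idealMl cJ).
  exact: (Defs.idealMr cJ).
have ch : continuous (diag h) by apply: diag_continuous; exact: ((CcP sL h).1 Ch).1.
have ch' : continuous (fun y => (diag h y)^-1).
  by move=> y; apply: (@cvgV C); [rewrite gt_eqF|exact: ch].
have J1 : J (iota (dg (fun=> 1))).
  have -> : dg (fun=> 1) = convol (dg (diag h)) (dg (fun y => (diag h y)^-1)).
    by rewrite convol_dg; congr dg; apply/funext => y; rewrite mulfV// gt_eqF.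
  rewrite (completionM ci); [|exact: (Cc_dg sL)|exact: (Cc_dg sL)].
  exact: (Defs.idealMr cJ).
apply/seteqP; split=> // a _.
have : closure (iota @` @Cc T R s) a by rewrite (completion_dense ci).
move=> aC; apply: (ideal_closed cJ); apply: closure_subset aC => _ [f Cf <-].
rewrite -(convol_dg1r f) (completionM ci)//; first exact: (idealMl cJ).
by apply: (Cc_dg sL); exact: cst_continuous.
Qed.

Lemma iota1_neq0 (x : T) : iota (dg (fun=> 1)) != 0.
Proof.
apply/eqP => i0; have := @rdg_eq0 (fun=> 1) _ x; rewrite /rdg.
have -> : (fun=> 1%:C) = (fun=> 1) :> (T -> C) by [].
rewrite (iota_inj0 _ i0); last by apply: (Cc_dg sL); exact: cst_continuous.
by move=> /(_ erefl)/eqP; rewrite oner_eq0.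
Qed.

Lemma exact_simple (x : T) :
  (forall U, open U -> U !=set0 -> exists n, iter n s @` U = setT) -> cstar_simple A.
Proof.
move=> ex; split; first by exists (iota (dg (fun=> 1))); exact: iota1_neq0.
move=> J cJ; have [nJ|] := pselect (no_positive_diag iota J).
  by left; exact: (no_positive_diag_ideal0 sL ci).
move=> /existsNP[b /not_implyP[cb /not_implyP[b0 /not_implyP[Jb /existsNP[y /eqP by0]]]]].
right; apply: (ideal_full (b := b)) => //; apply: ex.
  rewrite (_ : [set x | 0 < b x] = b @^-1` [set r | 0 < r])//.
  by apply: open_comp => [z _|]; [exact: cb|exact: open_gt].
by exists y; rewrite /= lt_neqAle eq_sym by0 b0.
Qed.

(** Multipliers from a general element of [A] are limits of multipliers from [Cc], and the closure
    absorbs the error. *)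
Lemma closure_closed_ideal (S : set (Rel s -> C)) : S `<=` @Cc T R s ->
  S (fun=> 0) -> (forall f g, S f -> S g -> S (fun p => f p + g p)) ->
  (forall z f, S f -> S (fun p => z * f p)) ->
  (forall f g, Cc f -> S g -> S (convol f g)) ->
  (forall f g, S f -> Cc g -> S (convol f g)) ->
  closed_ideal (closure (iota @` S)).
Proof.
move=> SC S0 SD SZ SMl SMr; set J := closure _.
have approx a : J a <-> forall e : R, 0 < e -> exists2 f, S f & nrm (a - iota f) < e.
  rewrite /J closureP; split=> H e /H.
    by move=> [_ [f Sf <-] ?]; exists f.
  by move=> [f Sf ?]; exists (iota f) => //; exists f.
have approx_iota a (e : R) : 0 < e -> exists2 f, Cc f & nrm (a - iota f) < e.
  move=> e0; have : closure (iota @` @Cc T R s) a by rewrite (completion_dense ci).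
  by move=> /closureP/(_ e e0)[_ [f Cf <-] af]; exists f.
(* The [+ 1] keeps the divisors below positive when the norm vanishes. *)
have nrm1 (a : A) : 0 < nrm a + 1 by have := nrm_ge0 a; lra.
have J0 : J 0 by rewrite -(iota0 sL ci); apply: subset_closure; exists (fun=> 0).
split=> //.
- exact: closed_closure.
- move=> a c /approx Ja /approx Jc; apply/approx => e e0.
  have e20 : 0 < e / 2 by rewrite divr_gt0.
  have [f Sf af] := Ja _ e20; have [g Sg cg] := Jc _ e20.
  exists (fun p => f p + g p); first exact: SD.
  rewrite (completionD ci); [|exact: SC|exact: SC].
  rewrite opprD addrACA; apply: le_lt_trans (nrmD _ _) _; lra.
- move=> z a; have [->|z0] := eqVneq z 0; first by rewrite scale0r.
  move=> /approx Ja; apply/approx => e e0.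
  have zr : `|z| = (complex.Re `|z|)%:C /\ 0 <= complex.Re `|z| by exact: real_ge0.
  have z0' : 0 < complex.Re `|z| by rewrite -ltcR -zr.1 normr_gt0.
  have [f Sf af] := Ja _ (divr_gt0 e0 z0').
  exists (fun p => z * f p); first exact: SZ.
  rewrite (completionZ ci); last exact: SC.
  rewrite -scalerBr -ltcR -nrmE normrZ zr.1 nrmE -rmorphM ltcR.
  by rewrite mulrC -ltr_pdivlMr.
- move=> a c /approx Jc.
  have Jf f : Cc f -> J (cmul (iota f) c).
    move=> Cf; apply/approx => e e0.
    have [g Sg cg] := Jc _ (divr_gt0 e0 (nrm1 (iota f))).
    exists (convol f g); first exact: SMl.
    rewrite (completionM ci) -?cmulNr -?cmulDr//; last exact: SC.
    apply: le_lt_trans (nrmM _ _) _.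
    rewrite ltr_pdivlMr// in cg; apply: le_lt_trans cg; rewrite mulrC.
    by rewrite ler_wpM2l ?nrm_ge0//; lra.
  apply: closed_closure; apply/closureP => e e0.
  have [f Cf af] := approx_iota a _ (divr_gt0 e0 (nrm1 c)).
  exists (cmul (iota f) c); first exact: Jf.
  rewrite -cmulNl -cmulDl; apply: le_lt_trans (nrmM _ _) _.
  rewrite ltr_pdivlMr// in af; apply: le_lt_trans af.
  by rewrite ler_wpM2l ?nrm_ge0//; lra.
- move=> c a /approx Jc.
  have Jf f : Cc f -> J (cmul c (iota f)).
    move=> Cf; apply/approx => e e0.
    have [g Sg cg] := Jc _ (divr_gt0 e0 (nrm1 (iota f))).
    exists (convol g f); first exact: SMr.
    rewrite (completionM ci) -?cmulNl -?cmulDl//; last exact: SC.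
    apply: le_lt_trans (nrmM _ _) _.
    rewrite ltr_pdivlMr// in cg; apply: le_lt_trans cg.
    by rewrite ler_wpM2l ?nrm_ge0//; lra.
  apply: closed_closure; apply/closureP => e e0.
  have [f Cf af] := approx_iota a _ (divr_gt0 e0 (nrm1 c)).
  exists (cmul c (iota f)); first exact: Jf.
  rewrite -cmulNr -cmulDr; apply: le_lt_trans (nrmM _ _) _.
  rewrite ltr_pdivlMr// in af; apply: le_lt_trans af; rewrite mulrC.
  by rewrite ler_wpM2l ?nrm_ge0//; lra.
Qed.

Lemma simple_exact b (x : T) : cstar_simple A -> continuous b ->
  (forall x, 0 <= b x) -> 0 < b x -> exists n, iter n s @` [set x | 0 < b x] = setT.
Proof.
move=> [_ simA] cb b0 bx.
pose V := [set x | 0 < b x].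
have oV : open V.
  rewrite (_ : V = b @^-1` [set r | 0 < r])//.
  by apply: open_comp => [z _|]; [exact: cb|exact: open_gt].
pose sat n := iter n s @^-1` (iter n s @` V).
have osat n : open (sat n).
  apply: open_comp => [z _|]; first exact: (iter_continuous sL).
  exact: (iter_open sL).
pose D := \bigcup_n sat n.
have sat_le m n : (m <= n)%N -> sat m `<=` sat n.
  move=> /subnK <- y [z Vz yz]; exists z => //.
  by rewrite !iterD yz.
have Dinv y z : Runion s (y, z) -> D y -> D z.
  move=> [n _ yz] [m _ my]; exists (n + m)%N => //.
  have [v Vv vy] := sat_le _ _ (leq_addl n m) _ my; exists v => //.
  by rewrite vy addnC !iterD yz.
(* As [D] is a union of classes, vanishing when the first point is off [D] is the same as vanishing
   when the second is; this makes [S] a two-sided ideal of [Cc]. *)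
pose S : set (Rel s -> C) := [set f | Cc f /\ forall y z, ~ D y -> ext0 f (y, z) = 0].
have SM f g : Cc f -> S g -> S (convol f g) /\ S (convol g f).
  move=> Cf Sg; have [Cg _] := Sg; have [n [fn gn]] := Cc_level2 sL Cf Cg.
  split; split; try exact: (Cc_convol sL).
  - move=> y z ny; rewrite (ext0_convol sL _ _ fn gn); case: asboolP => // yz.
    rewrite big1// => w _; case: asboolP => // /preP[_ pw].
    rewrite Sg.2 ?mulr0// => Dw; apply: ny; apply: Dinv Dw.
    by exists n => //; rewrite /Rn /= pw.
  - move=> y z ny; rewrite (ext0_convol sL _ _ gn fn); case: asboolP => // yz.
    by rewrite big1// => w _; case: asboolP => // _; rewrite Sg.2 ?mul0r.
have cJ : closed_ideal (closure (iota @` S)).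
  apply: closure_closed_ideal =>
    [f []//|||z f [Cf Sf]|f g Cf /(SM _ _ Cf)[]//|f g /[swap] Cg /(SM _ _ Cg)[]//].
  - by split=> [|y z _]; [exact: (Cc0 R sL)|rewrite /ext0; case: insub].
  - move=> f g [Cf Sf] [Cg Sg]; split; first exact: (Cc_add sL).
    by move=> y z ny; rewrite ext0D Sf ?Sg ?addr0.
  - by split=> [|y w ny]; [exact: (Cc_scale sL)|rewrite ext0Z Sf ?mulr0].
pose J := closure (iota @` S).
have SJ f : S f -> J (iota f) by move=> Sf; apply: subset_closure; exists f.
have C1 : Cc (dg (fun=> 1 : C)) by apply: (Cc_dg sL); exact: cst_continuous.
have DT y : D y.
  have [J0|JT] := simA J cJ.
    have : J (iota (rdg b)).
      apply: SJ; split; first exact: (Cc_rdg sL).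
      move=> z w nz; rewrite ext0_dg; case: eqP => // _.
      apply/eqP; rewrite eq_sym; apply/negP => /negP bz; apply: nz; exists 0%N => //=.
      exists z => //; rewrite /V /= lt_neqAle b0 andbT.
      by apply: contra bz => /eqP <-.
    rewrite J0 => /= /(iota_inj0 (Cc_rdg sL cb))/rdg_eq0/(_ x) bx0.
    by rewrite bx0 ltxx in bx.
  have : J (iota (dg (fun=> 1))) by rewrite JT.
  move=> /closureP/(_ (1 / 2))[|_ [f Sf <-] f1]; first by rewrite divr_gt0.
  (* For [y] off [D] the function 1 - f has the value 1 at (y, y), while its norm is below 1 / 2. *)
  apply: contrapT => ny; have [Cf _] := Sf.
  rewrite -scaleN1r -(completionZ ci)// -(completionD ci)// in f1; last exact: (Cc_scale sL).
  have := nrm_iota_ge y (Cc_add sL C1 (Cc_scale sL (-1) Cf)) (ltW f1).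
  rewrite /diag ext0D ext0Z ext0_dg eqxx Sf.2// mulr0 addr0 normr1.
  by rewrite -[1 : C]/(1%:C) lecR; lra.
have /compact_near_coveringP := lc_compact sL.
move=> /(_ nat \oo (fun n y => sat n y) _)[y _|n _ satn].
  have [n _ ny] := DT y.
  exists (sat n, [set m | (n <= m)%N]).
    by split=> /=; [apply: open_nbhs_nbhs; split|exists n].
  by move=> [z m] [/= zn nm]; exact: sat_le nm _ zn.
exists n; apply/seteqP; split=> // y _.
have [z <-] := iter_surj sL n y.
exact: (satn n (leqnn n) z).
Qed.

End SimpleExact.

(** * The order topology of the split interval *)

Lemma rays_continuous (R : realType) (T : topologicalType) (f : T -> R) :
  (forall x, open [set p | x < f p]) -> (forall x, open [set p | f p < x]) ->
  continuous f.
Proof.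
move=> of_gt of_lt p; apply/cvgrPdist_lt => e e0; near=> q.
rewrite ltr_distlC; apply/andP; split; near: q.
  by apply: open_nbhs_nbhs; split; [exact: of_gt|rewrite /=; lra].
by apply: open_nbhs_nbhs; split; [exact: of_lt|rewrite /=; lra].
Unshelve. all: by end_near. Qed.

Section SplitInterval.
Context {R : realType} (tau : R -> R).
Implicit Types (p q : X tau) (x y : R).

Definition side p : bool := (val (p : splitI tau)).2.

Lemma ltXE p q : (p < q) =
  (collapse p < collapse q) || ((collapse p == collapse q) && (~~ side p && side q)).
Proof.
rewrite -(@lt_val _ _ _ _ (splitI tau)) /collapse /side.
case: (val p) (val q) => a b [c d] /=.
rewrite Order.ProdLexiOrder.ltEprodlexi /=.
by case: (ltgtP a c) => _ //=; case: b; case: d.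
Qed.

Lemma collapse_unit p : 0 <= collapse p <= 1.
Proof. by have [+ _] := set_mem (valP (p : splitI tau)); rewrite /unitI /= in_itv. Qed.

Lemma side_I1 p : side p -> I1 tau (collapse p) /\ 0 < collapse p < 1.
Proof. by have [_] := set_mem (valP (p : splitI tau)). Qed.

Lemma exists_point x (b : bool) : 0 <= x <= 1 -> (b -> I1 tau x /\ 0 < x < 1) ->
  exists p, collapse p = x /\ side p = b.
Proof.
move=> Ix bx; have Ux : unitI x by rewrite /unitI /= in_itv.
by exists (Sub ((x, b) : R *l bool) (mem_set (conj Ux bx))); rewrite /collapse /side SubK.
Qed.

Lemma exists_left x : 0 <= x <= 1 -> exists2 p, collapse p = x & side p = false.
Proof. by move=> x01; have [//|p [px ps]] := @exists_point x false x01; exists p. Qed.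

Lemma point_inj p q : collapse p = collapse q -> side p = side q -> p = q.
Proof.
rewrite /collapse /side => pq1 pq2; apply: (@val_inj _ _ (splitI tau)).
exact: injective_projections.
Qed.

Lemma leXE p q : (p <= q) =
  (collapse p < collapse q) || ((collapse p == collapse q) && (side p ==> side q)).
Proof.
rewrite leNgt ltXE eq_sym.
by case: (ltgtP (collapse p)); case: (side p); case: (side q).
Qed.

Lemma ltX_collapse p q : collapse p < collapse q -> p < q.
Proof. by rewrite ltXE => ->. Qed.

Lemma leX_collapse p q : p <= q -> collapse p <= collapse q.
Proof. by rewrite leXE le_eqVlt => /orP[->|/andP[->]//]; rewrite orbT. Qed.

Lemma hausdorff_X : hausdorff_space (X tau).
Proof. exact: order_hausdorff. Qed.

(* An ultrafilter [F] converges to the supremum of the points [p] such that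
   [F] contains the ray [p, +oo[. *)
Lemma compact_X : compact [set: X tau].
Proof.
have i01 : 0 <= (0 : R) <= 1 by rewrite lexx ler01.
have [p0 p00 _] := exists_left i01.
rewrite compact_ultra => F UF _.
have PF : ProperFilter F by exact: ultra_proper.
pose S : set (X tau) := [set p | F [set q | p <= q]].
have S0 : S p0.
  rewrite /S /=; apply: filterS filterT => q _; rewrite /= leNgt ltXE p00 negb_or.
  have /andP[q0 _] := collapse_unit q; rewrite -leNgt q0 /=.
  apply/negP => /andP[/eqP q00 /andP[_ /side_I1[_]]].
  by rewrite p00 ltxx.
have [m [mub mlub]] : exists m, (forall p, S p -> p <= m) /\
    (forall q, (forall p, S p -> p <= q) -> m <= q).
  pose E := [set collapse p | p in S].
  have Eub : has_sup E.
    split; first by exists (collapse p0); exists p0.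
    by exists 1 => _ [p _ <-]; case/andP: (collapse_unit p).
  pose x := sup E.
  have xub p : S p -> collapse p <= x by move=> Sp; apply: sup_upper_bound => //; exists p.
  have x01 : 0 <= x <= 1.
    apply/andP; split; first by apply: le_trans (xub _ S0); rewrite p00.
    apply: (@ge_sup _ E); first by case: Eub.
    by move=> _ [p _ <-]; case/andP: (collapse_unit p).
  have xlub q : (forall p, S p -> p <= q) -> x <= collapse q.
    move=> qub; apply: (@ge_sup _ E); first by case: Eub.
    by move=> _ [p Sp <-]; apply: leX_collapse; exact: qub.
  have [[p [Sp px sp]]|np] := pselect (exists p, [/\ S p, collapse p = x & side p]).
    exists p; split=> [q Sq|q]; last exact.
    by rewrite leXE px sp implybT andbT orbC -le_eqVlt; exact: xub.
  have [m mx ms] := exists_left x01.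
  exists m; split=> [q Sq|q qub].
    rewrite leXE mx ms implybF; have := xub _ Sq; rewrite le_eqVlt => /orP[qx|->//].
    rewrite qx /= orbC; apply/orP; left; apply/negP => sq; apply: np.
    by exists q; split => //; exact/eqP.
  by rewrite leXE mx ms /= andbT orbC -le_eqVlt; exact: xlub.
exists m; split=> //= B; rewrite itv_nbhsE => -[i [iopen mi] iB].
apply: filterS iB _.
have Sdown p : p < m -> S p.
  move=> pm; have : ~ (forall q, S q -> q <= p).
    by move=> /mlub; rewrite leNgt pm.
  move=> /existsNP[q /not_implyP[Sq /negP]]; rewrite -ltNge => /ltW pq.
  by apply: filterS Sq => r /=; exact: le_trans.
have low p : p < m -> F [set q | p < q].
  move=> pm; have : ~ (forall q, S q -> q <= p).
    by move=> /mlub; rewrite leNgt pm.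
  move=> /existsNP[q /not_implyP[Sq /negP]]; rewrite -ltNge => pq.
  by apply: filterS Sq => r /=; exact: lt_le_trans.
have upp p : m < p -> F [set q | q < p].
  move=> mp; have [//|] := in_ultra_setVsetC [set q | q < p] UF.
  rewrite (_ : ~` _ = [set q | p <= q]); last first.
    by apply/seteqP; split => q /= => [/negP|pq]; [|apply/negP]; rewrite -leNgt.
  by move=> /mub; rewrite leNgt mp.
case: i iopen mi => -[[] l|[]] [[] r|[]] //= _; rewrite in_itv /= ?andbT => mi.
- case/andP: mi => lm mr; apply: (filterS _ (filterI (low _ lm) (upp _ mr))).
  by move=> q [/= lq qr]; rewrite in_itv /= lq.
- by apply: (filterS _ (low _ mi)) => q /= lq; rewrite in_itv /= lq.
- by apply: (filterS _ (upp _ mi)) => q /= lq; rewrite in_itv /= lq.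
- by apply: filterS filterT => q _; rewrite /= in_itv.
Qed.

Lemma open_collapse_gt x : open [set p : X tau | x < collapse p].
Proof.
rewrite openE => p /= xp; have [p0 p1] := andP (collapse_unit p).
have [x0|x0] := ltP x 0.
  apply: filterS filterT => q _ /=; apply: lt_le_trans x0 _.
  by case/andP: (collapse_unit q).
pose y := (x + collapse p) / 2.
have y01 : 0 <= y <= 1 by rewrite /y; apply/andP; split; lra.
have [q qy _] := exists_left y01.
have : nbhs p `]q, +oo[%classic.
  apply: open_nbhs_nbhs; split; first exact: rray_open.
  by rewrite /= in_itv /= andbT; apply: ltX_collapse; rewrite qy /y; lra.
apply: filterS => r; rewrite /= in_itv /= andbT => /ltW/leX_collapse.
by rewrite qy; apply: lt_le_trans; rewrite /y; lra.
Qed.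

Lemma open_collapse_lt x : open [set p : X tau | collapse p < x].
Proof.
rewrite openE => p /= px; have [p0 p1] := andP (collapse_unit p).
have [x1|x1] := ltP 1 x.
  apply: filterS filterT => q _ /=; apply: le_lt_trans x1.
  by case/andP: (collapse_unit q).
pose y := (x + collapse p) / 2.
have y01 : 0 <= y <= 1 by rewrite /y; apply/andP; split; lra.
have [q qy _] := exists_left y01.
have : nbhs p `]-oo, q[%classic.
  apply: open_nbhs_nbhs; split; first exact: lray_open.
  by rewrite /= in_itv /=; apply: ltX_collapse; rewrite qy /y; lra.
apply: filterS => r; rewrite /= in_itv /= => /ltW/leX_collapse.
by rewrite qy => /le_lt_trans; apply; rewrite /y; lra.
Qed.

Lemma collapse_continuous : continuous (@collapse R tau).
Proof. exact: rays_continuous open_collapse_gt open_collapse_lt. Qed.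

(* [below v] and [block u v] are the order intervals [0, v^-] and [u^+, v^-]
   ([0, v^-] when [u = 0]). *)
Definition below v : set (X tau) :=
  [set p | collapse p < v \/ collapse p = v /\ ~~ side p].

Definition block u v : set (X tau) := [set p | below v p /\ (0 < u -> ~ below u p)].

Lemma below_le u v : u <= v -> below u `<=` below v.
Proof.
move=> uv p [pu|[pu sp]]; first by left; exact: lt_le_trans uv.
by move: uv; rewrite le_eqVlt => /orP[/eqP <-|uv]; [right|left; rewrite pu].
Qed.

Lemma below1 p : below 1 p.
Proof.
have /andP[_] := collapse_unit p; rewrite le_eqVlt => /orP[/eqP p1|]; last by left.
right; split=> //; apply/negP => /side_I1[_].
by rewrite p1 ltxx andbF.
Qed.

(** For a doubled [v] the set is the open ray below v^+, and its complement the open ray above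
    v^-. *)
Lemma clopen_below v : I1 tau v -> 0 < v <= 1 -> clopen (below v).
Proof.
move=> Iv /andP[v0]; rewrite le_eqVlt => /orP[/eqP ->|v1].
  have -> : below 1 = setT by apply/seteqP; split=> // p _; exact: below1.
  exact: clopenT.
have v01 : 0 <= v <= 1 by rewrite !ltW.
have [p [pv ps]] := @exists_point v true v01 (fun=> conj Iv (andb_true_intro (conj v0 v1))).
have [m mv ms] := exists_left v01.
split; last rewrite -openC.
  suff -> : below v = `]-oo, p[%classic by exact: lray_open.
  apply/seteqP; split=> q; rewrite /below /= in_itv /= ltXE pv ps andbT.
    by move=> [->//|[-> ->]]; rewrite eqxx orbT.
  by move=> /orP[|/andP[/eqP]]; [left|right].
suff -> : ~` below v = `]m, +oo[%classic by exact: rray_open.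
apply/seteqP; split=> q; rewrite /below /= in_itv /= andbT ltXE mv ms /=.
  move=> /not_orP[/negP]; rewrite -leNgt le_eqVlt => /orP[/eqP vq|-> //].
  rewrite -vq eqxx ltxx /= => /not_andP[//|/negP].
  by rewrite negbK.
move=> /orP[vq [|[qv _]]|/andP[/eqP vq sq] [|[_]]].
- by move/(lt_trans vq); rewrite ltxx.
- by rewrite qv ltxx in vq.
- by rewrite vq ltxx.
- by rewrite sq.
Qed.

Lemma clopen_block u v : I1 tau u -> I1 tau v -> 0 <= u < v -> v <= 1 ->
  clopen (block u v).
Proof.
move=> Iu Iv /andP[u0 uv] v1.
have cv : clopen (below v) by apply: clopen_below; rewrite // v1 (le_lt_trans u0).
move: u0; rewrite le_eqVlt => /orP[/eqP u0|u0].
  suff -> : block u v = below v by [].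
  by apply/seteqP; split=> p; [case|split => //; rewrite -u0 ltxx].
suff -> : block u v = below v `&` ~` below u.
  apply: clopenI => //; apply: (@clopenC _ _ set0); apply: clopen_below => //.
  by rewrite u0 (le_trans (ltW uv)).
by apply/seteqP; split=> p [pv pu]; split=> //; exact: pu.
Qed.

Lemma block_itv u v p : u < collapse p < v -> block u v p.
Proof.
move=> /andP[up pv]; split=> [|u0]; first by left.
by move=> [|[pu _]]; [move/(lt_trans up); rewrite ltxx|rewrite pu ltxx in up].
Qed.

Lemma block01 p : block 0 1 p.
Proof. by split; [exact: below1|rewrite ltxx]. Qed.

Lemma block_collapse u v p : 0 <= u -> block u v p -> u <= collapse p <= v.
Proof.
move=> u0 [pv pu]; apply/andP; split.
  move: u0; rewrite le_eqVlt => /orP[/eqP <-|/pu]; first by case/andP: (collapse_unit p).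
  by move=> /not_orP[/negP]; rewrite -leNgt.
by case: pv => [/ltW//|[-> _]].
Qed.

(** Turns density of [I0] in the interval into density of [X0] in each block. The interval found
    lies to the right of [p] if [p] is some x^+ or the point 0, and to the left otherwise, so that
    it stays in the block. *)
Lemma nbhs_block u v p (B : set (X tau)) : 0 <= u < v -> v <= 1 ->
  block u v p -> nbhs p B ->
  exists c d, [/\ u <= c, c < d, d <= v & forall q, c < collapse q < d -> B q].
Proof.
move=> /andP[u0 uv] v1 uvp; rewrite itv_nbhsE => -[i [iopen pi] iB].
have /andP[up pv] := block_collapse u0 uvp.
have [c cp [d dp cdi]] : exists2 c, c < collapse p \/ c = collapse p /\ side p &
    exists2 d, collapse p < d \/ [/\ d = collapse p, ~~ side p & 0 < collapse p] &
    forall q, c < collapse q < d -> q \in i.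
  have lP l : l < p -> exists2 c, c < collapse p \/ c = collapse p /\ side p &
      forall q, c < collapse q -> l < q.
    move=> lp; exists (collapse l); last by move=> q; exact: ltX_collapse.
    by move: lp; rewrite ltXE => /orP[|/and3P[/eqP]]; [left|right].
  have rP r : p < r -> exists2 d,
      collapse p < d \/ [/\ d = collapse p, ~~ side p & 0 < collapse p] &
      forall q, collapse q < d -> q < r.
    move=> pr; exists (collapse r); last by move=> q; exact: ltX_collapse.
    move: pr; rewrite ltXE => /orP[|/and3P[/eqP pr ps /side_I1[_ /andP[r0 _]]]]; [left|right] => //.
    by rewrite pr.
  have cN : collapse p - 1 < collapse p \/ collapse p - 1 = collapse p /\ side p by left; lra.
  have dN : collapse p < collapse p + 1 \/
    [/\ collapse p + 1 = collapse p, ~~ side p & 0 < collapse p] by left; lra.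
  case: i iopen pi {iB} => -[[] l|[]] [[] r|[]] //= _; rewrite in_itv /= ?andbT => pi.
  - have /andP[/lP[c cp lc] /rP[d dp rd]] := pi.
    exists c => //; exists d => // q /andP[cq qd]; rewrite in_itv /=.
    by rewrite lc// rd.
  - have [c cp lc] := lP _ pi; exists c => //; exists (collapse p + 1) => //.
    by move=> q /andP[cq _]; rewrite in_itv /= lc.
  - have [d dp rd] := rP _ pi; exists (collapse p - 1) => //; exists d => //.
    by move=> q /andP[_ qd]; rewrite in_itv /= rd.
  - by exists (collapse p - 1) => //; exists (collapse p + 1).
have B_cd q : c < collapse q < d -> B q by move=> /cdi qi; exact: iB.
have [pv' pu'] := uvp.
have [ps|ps] := boolP (side p).
  have pv'' : collapse p < v by case: pv' => // -[_]; rewrite ps.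
  have pd : collapse p < d by case: dp => // -[_]; rewrite ps.
  exists (collapse p), (Num.min d v); rewrite lt_min pd pv'' ge_min !lexx ?orbT; split=> // q.
  rewrite lt_min => /and3P[pq qd _]; apply: B_cd; rewrite qd andbT.
  by apply: le_lt_trans pq; case: cp => [/ltW //|[-> _]].
have cp' : c < collapse p by case: cp => // -[_]; rewrite (negbTE ps).
have [up'|pu''] := ltP u (collapse p).
  exists (Num.max c u), (collapse p); rewrite gt_max cp' up' le_max !lexx ?orbT; split=> // q.
  rewrite gt_max => /andP[/andP[cq _] qp]; apply: B_cd; rewrite cq.
  by apply: lt_le_trans qp _; case: dp => [/ltW //|[-> _ _]].
have pu0 : collapse p = u by apply/eqP; rewrite eq_le pu'' up.
have u00 : u = 0.
  apply/eqP; rewrite eq_le u0 andbT leNgt; apply/negP => /pu'; apply.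
  by right.
have pd : collapse p < d by case: dp => // -[_ _]; rewrite pu0 u00 ltxx.
exists u, (Num.min d v); rewrite lt_min uv -pu0 pd ge_min !lexx ?orbT; split=> // q.
rewrite lt_min => /and3P[pq qd _]; apply: B_cd; rewrite qd andbT.
exact: lt_trans pq.
Qed.

End SplitInterval.

(** * Branches of a piecewise monotonic map *)

Section StrictlyMonotone.
Context {R : realType}.
Implicit Types (f : R -> R) (a b e : R).

(* [e] is [1] for increasing and [-1] for decreasing functions. *)
Definition strict_mono_by e f a b := forall x y, a < x -> x < y -> y < b ->
  e * f x < e * f y.

Lemma strict_mono_by_cvg e f a b : a < b -> e * e = 1 ->
  (forall x, a < x < b -> 0 <= f x <= 1) -> strict_mono_by e f a b ->
  cvg (f x @[x --> a^'+]) /\ cvg (f x @[x --> b^'-]).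
Proof.
move=> ab ee f01 mf; pose g x := e * f x.
have gE : f = (fun x => e * g x) by apply/funext => x; rewrite /g mulrA ee mul1r.
have gle x y : a < x -> x <= y -> y < b -> g x <= g y.
  by move=> ax; rewrite le_eqVlt => /orP[/eqP ->//|xy] yb; exact/ltW/mf.
have gb x : a < x < b -> `|g x| <= `|e|.
  move=> /f01/andP[f0 f1]; rewrite normrM ler_piMr// ger0_norm//.
have near_r (P : R -> Prop) : (forall x, a < x < b -> P x) -> \forall x \near a^'+, P x.
  by move=> HP; near=> x; apply: HP; apply/andP; split; near: x;
    [exact: nbhs_right_gt|exact: nbhs_right_lt].
have near_l (P : R -> Prop) : (forall x, a < x < b -> P x) -> \forall x \near b^'-, P x.
  by move=> HP; near=> x; apply: HP; apply/andP; split; near: x;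
    [exact: nbhs_left_gt|exact: nbhs_left_lt].
have cr : cvg (g x @[x --> a^'+]).
  apply: nondecreasing_at_right_is_cvgr; apply: near_r => x /andP[ax xb].
    move=> y z; rewrite !in_itv /= => /andP[ay yx] /andP[az zx] yz.
    by apply: gle => //; exact: lt_trans xb.
  exists (- `|e|) => z [y]; rewrite /= in_itv /= => /andP[ay yx] <-.
  by have := gb y; rewrite ay (lt_trans yx xb) ler_norml => /(_ isT)/andP[].
have cl : cvg (g x @[x --> b^'-]).
  apply: nondecreasing_at_left_is_cvgr; apply: near_l => x /andP[ax xb].
    move=> y z + + yz; rewrite !in_itv /= => /andP[xy yb] /andP[xz zb].
    by apply: gle => //; exact: lt_trans xy.
  exists (`|e|) => z [y]; rewrite /= in_itv /= => /andP[xy yb] <-.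
  by have := gb y; rewrite yb (lt_trans ax xy) ler_norml => /(_ isT)/andP[].
by rewrite gE; split; apply: is_cvgMr.
Unshelve. all: by end_near. Qed.

Lemma strict_mono_by_closure e f a b : a < b -> {within `[a, b], continuous f} ->
  strict_mono_by e f a b ->
  forall x y, a <= x -> x < y -> y <= b -> e * f x < e * f y.
Proof.
move=> ab /(continuous_within_itvP _ ab)[_ fa fb] mf x y ax xy yb.
have lea z : a < z < b -> e * f a <= e * f z.
  move=> /andP[az zb]; apply: (@cvgr_to_le _ (at_right a) _ R (fun t => e * f t)).
    by apply: cvgM; [exact: cvg_cst|exact: fa].
  by near=> t; apply/ltW/mf.
have leb z : a < z < b -> e * f z <= e * f b.
  move=> /andP[az zb]; apply: (@cvgr_to_ge _ (at_left b) _ R (fun t => e * f t)).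
    by apply: cvgM; [exact: cvg_cst|exact: fb].
  by near=> t; apply/ltW/mf.
have lex z : x < z < y -> e * f x <= e * f z.
  move=> /andP[xz zy]; move: (ax); rewrite le_eqVlt => /orP[/eqP ax'|ax'].
    rewrite -ax'.
    by apply: lea; rewrite (le_lt_trans ax)//= (lt_le_trans zy).
  by apply/ltW/mf => //; exact: lt_le_trans yb.
have ley z : x < z < y -> e * f z <= e * f y.
  move=> /andP[xz zy]; move: (yb); rewrite le_eqVlt => /orP[/eqP ->|yb'].
    by apply: leb; rewrite (le_lt_trans ax)//= (lt_le_trans zy).
  by apply/ltW/mf => //; exact: le_lt_trans xz.
(* Limits at the ends give weak inequalities only; strictness comes from two interior points. *)
pose z := (x + x + y) / 3; pose w := (x + y + y) / 3.
apply: (@le_lt_trans _ _ (e * f z)).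
  by apply: lex; apply/andP; split; rewrite /z; lra.
apply: (@lt_le_trans _ _ (e * f w)).
  by apply: mf; rewrite /z /w; lra.
by apply: ley; apply/andP; split; rewrite /w; lra.
Unshelve. all: by end_near. Qed.

End StrictlyMonotone.

Section Branches.
Context {R : realType} (tau : R -> R).
Hypotheses (tau_pm : piecewise_monotonic tau) (tau_surj : hat_surjective tau).
Local Notation c := (pm_partition tau).
Implicit Types (x y u v : R) (i : nat) (A : set R).

(** The default [[::]] of [xget] would make [hat tau] empty, contradicting surjectivity; so a
    maximal partition exists and was chosen. *)
Lemma pm_partitionP : monotone_partition tau c /\ (1 < size c)%N.
Proof.
have : unitI (0 : R) by rewrite /unitI /= in_itv /= lexx ler01.
rewrite -tau_surj => -[i ic _]; rewrite /= in ic.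
split; last exact: leq_ltn_trans ic.
by move: ic; rewrite /pm_partition; case: xgetP => // p _ [].
Qed.

Lemma partition_lt i j : (i < j < size c)%N -> c`_i < c`_j.
Proof.
have [[sc _ _ _] _] := pm_partitionP; move=> /andP[ij jc].
by apply: (sorted_ltn_nth lt_trans) => //; rewrite inE//; exact: ltn_trans jc.
Qed.

Lemma partition_le i j : (i <= j < size c)%N -> c`_i <= c`_j.
Proof.
rewrite leq_eqVlt => /andP[/predU1P[->//|ij] jc].
by apply/ltW/partition_lt; rewrite ij.
Qed.

Lemma partition0 : c`_0 = 0.
Proof. by have [[]] := pm_partitionP. Qed.

Lemma partition_last : c`_(size c).-1 = 1.
Proof. by have [[_ _ + _] _] := pm_partitionP; rewrite nth_last; case: c. Qed.

Lemma partition_ge0 i : (i < size c)%N -> 0 <= c`_i.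
Proof. by move=> ic; rewrite -[leLHS]partition0; apply: partition_le. Qed.

Lemma partition_le1 i : (i < size c)%N -> c`_i <= 1.
Proof.
move=> ic; rewrite -[leRHS]partition_last; apply: partition_le.
by case: (size c) ic => // n; rewrite ltnS /= => ->; rewrite ltnSn.
Qed.

Section Branch.
Context (i : nat).
Hypothesis ic : (i.+1 < size c)%N.
Local Notation a := (c`_i).
Local Notation b := (c`_i.+1).

Lemma branch_ends : [/\ 0 <= a, a < b & b <= 1].
Proof.
split; [exact/partition_ge0/ltnW|apply: partition_lt|exact: partition_le1].
by rewrite ltnSn.
Qed.

Lemma branch_in x : a < x < b -> branch tau i x = tau x.
Proof. by move=> /andP[ax xb]; rewrite /branch gt_eqF// lt_eqF. Qed.

Lemma branch_continuous_mono : {within `[a, b], continuous (branch tau i)} /\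
  exists2 e : R, e * e = 1 & strict_mono_by e (branch tau i) a b.
Proof.
have [a0 ab b1] := branch_ends.
have [[_ _ _ /(_ i ic)[ctau mtau]] _] := pm_partitionP.
have [e ee me] : exists2 e : R, e * e = 1 & strict_mono_by e tau a b.
  case: mtau => mtau; [exists 1; first by rewrite mulr1|exists (-1); first by rewrite mulrNN mulr1].
    move=> x y ax xy yb; rewrite !mul1r; apply: mtau => //; rewrite in_itv /=.
      by rewrite ax (lt_trans xy).
    by rewrite yb (lt_trans ax).
  move=> x y ax xy yb; rewrite !mulN1r ltrN2; apply: mtau => //; rewrite in_itv /=.
    by rewrite yb (lt_trans ax).
  by rewrite ax (lt_trans xy).
have tau01 x : a < x < b -> 0 <= tau x <= 1.
  move=> /andP[ax xb]; have [tI _] := tau_pm.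
  have := tI x; rewrite /unitI /= !in_itv /=; apply.
  by rewrite (le_trans a0 (ltW ax)) (le_trans (ltW xb) b1).
have [ca cb] := strict_mono_by_cvg ab ee tau01 me.
split; last first.
  exists e => // x y ax xy yb.
  by rewrite !branch_in ?ax ?yb ?(lt_trans ax xy) ?(lt_trans xy yb)//; exact: me.
apply/continuous_within_itvP => //; split.
- move=> x xab; apply: near_eq_continuous (ctau x xab).
  have : nbhs x `]a, b[%classic by apply: open_nbhs_nbhs; split.
  by apply: filterS => y; rewrite /= in_itv /= => yab; rewrite branch_in.
- rewrite [X in _ --> X]/branch eqxx; apply: cvg_trans ca.
  apply: near_eq_cvg; near=> x; rewrite branch_in//; apply/andP; split; near: x.
    exact: nbhs_right_gt.
  exact: nbhs_right_lt.
- rewrite [X in _ --> X]/branch eqxx gt_eqF//; apply: cvg_trans cb.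
  apply: near_eq_cvg; near=> x; rewrite branch_in//; apply/andP; split; near: x.
    exact: nbhs_left_gt.
  exact: nbhs_left_lt.
Unshelve. all: by end_near. Qed.

Lemma branch_mono : exists2 e : R, e * e = 1 &
  forall x y, a <= x -> x < y -> y <= b -> e * branch tau i x < e * branch tau i y.
Proof.
have [_ ab _] := branch_ends; have [cb [e ee me]] := branch_continuous_mono.
by exists e => //; exact: strict_mono_by_closure.
Qed.

Lemma branch_inj x y : a <= x <= b -> a <= y <= b ->
  branch tau i x = branch tau i y -> x = y.
Proof.
move=> /andP[ax xb] /andP[ay yb] xy; have [e _ me] := branch_mono.
by case: (ltgtP x y) => // [/me|/me]; rewrite xy ltxx => /(_ _ _)/negP; case.
Qed.

Lemma hat_branch A x : A x -> a <= x <= b -> hat tau A (branch tau i x).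
Proof.
by move=> Ax xab; exists i => //; exists x.
Qed.

Lemma branch01 x : a <= x <= b -> 0 <= branch tau i x <= 1.
Proof.
move=> xab; have : unitI (branch tau i x).
  rewrite -tau_surj; apply: hat_branch => //; rewrite /unitI /= in_itv /=.
  have [a0 _ b1] := branch_ends; case/andP: xab => ax xb.
  by rewrite (le_trans a0) ?(le_trans xb).
by rewrite /unitI /= in_itv.
Qed.

End Branch.

Lemma hatP A y : hat tau A y <-> exists i x,
  [/\ (i.+1 < size c)%N, A x, c`_i <= x <= c`_i.+1 & branch tau i x = y].
Proof.
split=> [[i /= ic [x [Ax]]]|[i [x [ic Ax xab <-]]]]; last exact: hat_branch.
by rewrite /branch_dom /= in_itv /= => xab xy; exists i, x.
Qed.

Lemma hat_invP A x : hat_inv tau A x <-> exists i,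
  [/\ (i.+1 < size c)%N, c`_i <= x <= c`_i.+1 & A (branch tau i x)].
Proof.
split=> [[i /= ic []]|[i [ic xab Ax]]].
  by rewrite /branch_dom /= in_itv /= => xab Ax; exists i.
by exists i => //; split=> //; rewrite /branch_dom /= in_itv.
Qed.

Lemma hat_mono A B : A `<=` B -> hat tau A `<=` hat tau B.
Proof.
move=> AB y /hatP[i [x [ic Ax xab xy]]]; apply/hatP; exists i, x; split=> //.
exact: AB.
Qed.

Lemma hat_unit A : A `<=` unitI -> hat tau A `<=` unitI.
Proof. by move=> /hat_mono; rewrite tau_surj. Qed.

Lemma hat_inv_unit A : hat_inv tau A `<=` unitI.
Proof.
move=> x /hat_invP[i [ic /andP[ax xb] _]]; have [a0 _ b1] := branch_ends ic.
by rewrite /unitI /= in_itv /= (le_trans a0) ?(le_trans xb).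
Qed.

Lemma partition_unit : [set` c] `<=` (unitI : set R).
Proof.
move=> x /= /(nthP 0)[i ic <-].
by rewrite /unitI /= in_itv /= partition_ge0 ?partition_le1.
Qed.

Lemma I1_partition i : (i < size c)%N -> I1 tau c`_i.
Proof. by move=> ic M [_]; apply; rewrite /= mem_nth. Qed.

Lemma I1_branch i x : (i.+1 < size c)%N -> c`_i <= x <= c`_i.+1 ->
  I1 tau x <-> I1 tau (branch tau i x).
Proof.
move=> ic xab; split=> Ix M MP; have [[_ hM hiM] _] := MP.
  by apply: hM; apply: hat_branch => //; exact: (Ix M MP).
by apply: hiM; apply/hat_invP; exists i; split => //; exact: (Ix M MP).
Qed.

(** [I1] is exhausted by repeated images and preimages of the partition; preimages of countable sets
    stay countable because the finitely many branches are injective. *)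
Lemma countable_I1 : countable (I1 tau).
Proof.
pose G A := A `|` (hat tau A `|` hat_inv tau A).
pose M n := iter n G [set` c].
have GM n : M n.+1 = G (M n) by [].
have cI : countable [set i | (i.+1 < size c)%N] by exact: countableP.
have cM n : countable (M n).
  elim: n => [|n ih]; first by apply: finite_set_countable; exact: finite_seq.
  have cU A B : countable A -> countable B -> countable (A `|` B :> set R).
    move=> cA cB; rewrite -bigcup2E; apply: bigcup_countable; first exact: countableP.
    by move=> [|[|j]] _ /=.
  rewrite GM; apply: (cU) => //; apply: (cU); apply: bigcup_countable => // i ic.
    apply: sub_countable (card_image_le _ _) _.
    by apply: sub_countable ih; apply: subset_card_le => x [].
  have inj : {in branch_dom tau i `&` branch tau i @^-1` M n &, injective (branch tau i)}.
    move=> x y /set_mem[+ _] /set_mem[+ _]; rewrite /branch_dom /= !in_itv /=.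
    exact: branch_inj.
  rewrite -(eq_countable (inj_card_eq inj)).
  by apply: sub_countable ih; apply: subset_card_le => _ [x [_ Mx] <-].
suff : I1 tau `<=` \bigcup_n M n.
  move=> /subset_card_le/sub_countable; apply; apply: bigcup_countable => //.
apply: smallest_sub; last by move=> x cx; exists 0%N.
have MI n : M n `<=` unitI.
  elim: n => [|n ih]; first exact: partition_unit.
  by move=> x [/ih //|[/(hat_unit ih)//|/hat_inv_unit]].
split.
- by move=> x [n _ /MI].
- move=> y /hatP[i [x [ic [n _ Mx] xab xy]]]; exists n.+1 => //.
  by rewrite GM; right; left; apply/hatP; exists i, x.
- move=> x /hat_invP[i [ic xab [n _ Mx]]]; exists n.+1 => //.
  by rewrite GM; right; right; apply/hat_invP; exists i.
Qed.

(** An interval has positive measure, so the countable set [I1] cannot contain it. *)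
Lemma I0_dense u v : 0 <= u -> u < v -> v <= 1 -> exists2 x, u < x < v & I0 tau x.
Proof.
move=> u0 uv v1; apply: contrapT => noI0.
have : countable (`]u, v[%classic : set R).
  apply: sub_countable countable_I1; apply: subset_card_le => x.
  rewrite /= in_itv /= => xuv; apply: contrapT => nx; apply: noI0; exists x => //.
  split => //; case/andP: xuv => ux xv.
  by rewrite /unitI /= in_itv /= (le_trans u0 (ltW ux)) (le_trans (ltW xv)).
move=> /countable_lebesgue_measure0; rewrite lebesgue_measure_itv /= lte_fin uv.
by move=> /eqP; rewrite -EFinD eqe subr_eq0 gt_eqF.
Qed.

End Branches.

(** * The associated local homeomorphism *)

Section AssociatedMap.
Context {R : realType} (tau : R -> R).
Hypotheses (tau_pm : piecewise_monotonic tau) (tau_surj : hat_surjective tau).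
Context (s : X tau -> X tau).
Hypothesis (s_tau : associated_map s).
Local Notation c := (pm_partition tau).
Local Notation M := ((size c).-1).
Implicit Types (p q r : X tau) (x y u v : R) (i : nat) (A : set R).

Let s_cont : continuous s := s_tau.1.

Lemma X0_side p : X0 p -> side p = false.
Proof. by move=> [_ np]; apply/negP => /side_I1[/np]. Qed.

Lemma X0_ex x : I0 tau x -> exists2 p : X tau, X0 p & collapse p = x.
Proof.
move=> Ix; have x01 : 0 <= x <= 1 by have [+ _] := Ix; rewrite /unitI /= in_itv.
have [p px _] := exists_left tau x01.
by exists p => //; rewrite /X0 /= px.
Qed.

Lemma block_dense u v p (B : set (X tau)) : 0 <= u < v -> v <= 1 ->
  block u v p -> nbhs p B -> exists q, [/\ X0 q, u < collapse q < v & B q].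
Proof.
move=> uv v1 uvp pB; have [a [b [ua ab bv abB]]] := nbhs_block uv v1 uvp pB.
have [u0 _] := andP uv.
have [x xab Ix] := I0_dense tau_pm tau_surj (le_trans u0 ua) ab (le_trans bv v1).
have [q Xq qx] := X0_ex Ix; exists q; split=> //; last by apply: abB; rewrite qx.
rewrite qx; case/andP: xab => ax xb.
by rewrite (le_lt_trans ua) ?(lt_le_trans xb).
Qed.

Definition piece i : set (X tau) := block c`_i c`_i.+1.

Section Piece.
Context (i : nat).
Hypothesis ic : (i.+1 < size c)%N.
Local Notation a := (c`_i).
Local Notation b := (c`_i.+1).

Lemma piece_ends : [/\ 0 <= a < b, b <= 1, I1 tau a & I1 tau b].
Proof.
have [a0 ab b1] := branch_ends tau_surj ic.
by rewrite a0 ab b1; split=> //; apply: I1_partition => //; exact: ltnW.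
Qed.

Lemma clopen_piece : clopen (piece i).
Proof. by have [ab b1 Ia Ib] := piece_ends; exact: clopen_block. Qed.

Lemma piece_collapse p : piece i p -> a <= collapse p <= b.
Proof. by have [/andP[a0 _] _ _ _] := piece_ends; exact: block_collapse. Qed.

(** The identity is given on [X0], which is dense in the piece, and both sides are continuous, the
    branch up to its end points. *)
Lemma collapse_s p : piece i p -> collapse (s p) = branch tau i (collapse p).
Proof.
move=> ip; have [ab b1 Ia Ib] := piece_ends.
apply/eqP; rewrite -subr_eq0 -normr_eq0 eq_le normr_ge0 andbT.
apply/ler_addgt0Pr => e e0; rewrite add0r.
have e20 : 0 < e / 2 by rewrite divr_gt0.
have sB : nbhs p [set q | `|collapse (s p) - collapse (s q)| < e / 2].
  have cs : {for p, continuous (fun q => collapse (s q))}.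
    apply: (@continuous_comp _ _ _ s (@collapse R tau)); first exact: s_cont.
    exact: collapse_continuous.
  by move: cs => /cvgrPdist_lt/(_ _ e20).
have [cb _] := branch_continuous_mono tau_pm tau_surj ic.
have bB : nbhs p [set q | piece i q ->
    `|branch tau i (collapse p) - branch tau i (collapse q)| < e / 2].
  have pab : (`[a, b]%classic : set R) (collapse p).
    by rewrite /= in_itv /=; exact: piece_collapse.
  have /subspace_continuousP/(_ _ pab)/cvgrPdist_lt/(_ _ e20) := cb.
  move=> /(@collapse_continuous R tau p) H.
  apply: (@filterS (X tau) (nbhs p) _ _ _ _ H) => q /= Hq iq.
  by apply: Hq; rewrite /= in_itv /=; exact: piece_collapse.
have [q [Xq qab [sq bq]]] := block_dense ab b1 ip (filterI sB bB).
have iq : piece i q by exact: block_itv.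
have sqE : collapse (s q) = branch tau i (collapse q).
  by rewrite branch_in//; exact: (s_tau.2).
have := bq iq; rewrite /= in sq; rewrite -sqE => bq'.
rewrite (_ : _ - _ = (collapse (s p) - collapse (s q)) -
  (branch tau i (collapse p) - collapse (s q))); last by lra.
apply: le_trans (ler_normB _ _) _; lra.
Qed.

Lemma s_X0 p : piece i p -> X0 p -> X0 (s p).
Proof.
move=> ip [_ np]; split; first by rewrite /unitI /= in_itv /=; exact: collapse_unit.
rewrite (collapse_s ip); have := piece_collapse ip => pab.
by apply: contra_not np => /(I1_branch ic pab).
Qed.

(** [m] and [m'] are the end values of the branch in increasing order. They lie in [I1] by
    invariance, so the block between them is clopen. *)
Lemma branch_block : exists m m', [/\ 0 <= m < m', m' <= 1, I1 tau m, I1 tau m' &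
  (forall x, a < x < b -> m < branch tau i x < m') /\
  (forall y, m < y < m' -> exists2 x, a < x < b & branch tau i x = y)].
Proof.
have [/andP[a0 ab] b1 Ia Ib] := piece_ends.
have [cb _] := branch_continuous_mono tau_pm tau_surj ic.
have [e ee me] := branch_mono tau_pm tau_surj ic.
set f := branch tau i in cb me *.
have aab : a <= a <= b by rewrite lexx ltW.
have bab : a <= b <= b by rewrite lexx ltW.
have /andP[fa0 fa1] := branch01 tau_surj ic aab.
have /andP[fb0 fb1] := branch01 tau_surj ic bab.
have Ifa := (I1_branch ic aab).1 Ia.
have Ifb := (I1_branch ic bab).1 Ib.
rewrite -/f in fa0 fa1 fb0 fb1 Ifa Ifb.
have ivt y : Num.min (f a) (f b) < y < Num.max (f a) (f b) ->
    exists2 x, a < x < b & f x = y.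
  move=> /andP[my yM].
  have yy : Num.min (f a) (f b) <= y <= Num.max (f a) (f b) by rewrite !ltW.
  have [x xab fx] := IVT (ltW ab) cb yy.
  move: xab; rewrite in_itv /= => /andP[]; rewrite !le_eqVlt.
  move=> /orP[/eqP ax|ax] /orP[/eqP xb|xb].
  - by rewrite ax xb ltxx in ab.
  - move: my yM; rewrite -fx -ax lt_max gt_min ltxx /=.
    by move=> /lt_trans/[apply]; rewrite ltxx.
  - move: my yM; rewrite -fx xb lt_max gt_min ltxx /= !orbF.
    by move=> /lt_trans/[apply]; rewrite ltxx.
  - by exists x => //; rewrite ax.
have e1 : e = 1 \/ e = -1.
  have /eqP : (e - 1) * (e + 1) = 0 by rewrite -subr_sqr expr1n expr2 ee subrr.
  by rewrite mulf_eq0 subr_eq0 addr_eq0 => /orP[] /eqP; [left|right].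
case: e1 => e1; move: me; rewrite e1 => me.
  have fab : f a < f b by have := me a b (lexx _) ab (lexx _); rewrite !mul1r.
  exists (f a), (f b); rewrite fa0 fab fb1; split=> //; split=> [x /andP[ax xb]|y].
    have := me _ _ (lexx a) ax (ltW xb); have := me _ _ (ltW ax) xb (lexx b).
    by rewrite !mul1r => -> ->.
  by move=> yab; apply: ivt; rewrite min_l ?max_r// ltW.
have fab : f b < f a by have := me a b (lexx _) ab (lexx _); rewrite !mulN1r ltrN2.
exists (f b), (f a); rewrite fb0 fab fa1; split=> //; split=> [x /andP[ax xb]|y].
  have := me _ _ (lexx a) ax (ltW xb); have := me _ _ (ltW ax) xb (lexx b).
  by rewrite !mulN1r !ltrN2 => -> ->.
by move=> yab; apply: ivt; rewrite min_r ?max_l// ltW.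
Qed.

(* At a doubled point [x], if [s x^- = s x^+] then the one-sided clopen
   neighbourhood of this value makes [x] a local extremum of [branch tau i]. *)
Lemma s_inj_piece p q : piece i p -> piece i q -> s p = s q -> p = q.
Proof.
move=> ip iq spq; have [ab b1 Ia Ib] := piece_ends.
have pq : collapse p = collapse q.
  apply: (branch_inj tau_pm tau_surj ic); try exact: piece_collapse.
  by rewrite -!collapse_s// spq.
apply: point_inj => //; apply: contrapT => /eqP.
wlog : p q ip iq spq pq / ~~ side p && side q.
  move=> H; case sp: (side p); case sq: (side q) => // _.
    by apply: (H q p) => //; rewrite sp sq.
  by apply: (H p q) => //; rewrite sp sq.
move=> /andP[sp sq] _.
have [Ix x01] := side_I1 sq.
have xb : collapse q < b by case: iq => -[//|[_ +] _]; rewrite sq.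
have ax : a < collapse p.
  case/andP: ab; rewrite le_eqVlt => /orP[/eqP <- _|a0 _]; first by rewrite pq; case/andP: x01.
  case: ip => _ /(_ a0) /not_orP[/negP]; rewrite -leNgt le_eqVlt => /orP[/eqP axE|//].
  by move=> /not_andP[] //; rewrite axE.
rewrite -pq in Ix x01 xb; set x := collapse p in pq ax xb Ix x01.
have xab : a < x < b by rewrite ax.
have [m [m' [/andP[m0 mm'] m'1 _ _ [bmm' _]]]] := branch_block.
set y := branch tau i x; have /andP[my ym'] : m < y < m' by exact: bmm'.
have y01 : 0 < y <= 1 by rewrite (le_lt_trans m0) ?(le_trans (ltW ym')).
have spy : collapse (s p) = y by rewrite collapse_s.
have xab' : a <= x <= b by apply/andP; split; exact: ltW.
have Iy : I1 tau y by exact/(I1_branch ic xab').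
have [oy cy] := clopen_below Iy y01.
have [e ee me] := branch_mono tau_pm tau_surj ic.
have px : block a x p by split; [right|case: ip].
have qx : block x b q.
  split; first by left; rewrite -pq.
  by move=> _ [|[]]; rewrite -pq ?ltxx ?sq.
have sides B : open B -> B (s p) -> exists2 z, a < z < x & exists2 z', x < z' < b &
    exists p' q', [/\ B p', collapse p' = branch tau i z, B q' & collapse q' = branch tau i z'].
  move=> oB Bsp; have Bp : nbhs p (s @^-1` B) by apply: s_cont; apply: open_nbhs_nbhs.
  have Bq : nbhs q (s @^-1` B).
    by apply: s_cont; apply: open_nbhs_nbhs; split=> //; rewrite -spq.
  have a0 : 0 <= a by case/andP: ab.
  have a0x : 0 <= a < x by rewrite a0.
  have x0b : 0 <= x < b by rewrite xb (le_trans a0 (ltW ax)).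
  have [p' [_ p'x Bp']] := block_dense a0x (le_trans (ltW xb) b1) px Bp.
  have [q' [_ q'x Bq']] := block_dense x0b b1 qx Bq.
  exists (collapse p') => //; exists (collapse q') => //; exists (s p'), (s q').
  case/andP: p'x => ap' p'x; case/andP: q'x => xq' q'b.
  split => //; apply: collapse_s; apply: block_itv.
    by rewrite ap' (lt_trans p'x).
  by rewrite q'b (lt_trans ax).
have no_extremum B : open B -> B (s p) ->
    (forall r, B r -> collapse r <= y) \/ (forall r, B r -> y <= collapse r) -> False.
  move=> oB Bsp By.
  have [z /andP[az zx] [z' /andP[xz' z'b] [p' [q' [Bp' p'z Bq' q'z]]]]] := sides B oB Bsp.
  have ez := me _ _ (ltW az) zx (ltW xb); have ez' := me _ _ (ltW ax) xz' (ltW z'b).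
  rewrite -p'z -/y in ez; rewrite -q'z -/y in ez'.
  have e1 : 0 <= e \/ e <= 0 by case: (leP 0 e); [left|right; exact: ltW].
  case: By => By; have := By _ Bp'; have := By _ Bq' => By1 By2.
    case: e1 => e0.
      by have := lt_le_trans ez' (ler_wpM2l e0 By1); rewrite ltxx.
    by have := lt_le_trans ez (ler_wnM2l e0 By2); rewrite ltxx.
  case: e1 => e0.
    by have := lt_le_trans ez (ler_wpM2l e0 By2); rewrite ltxx.
  by have := lt_le_trans ez' (ler_wnM2l e0 By1); rewrite ltxx.
have [sps|sps] := pselect (below y (s p)).
  apply: (no_extremum (below y)) => //; left=> r.
  by move=> [/ltW//|[-> _]].
apply: (no_extremum (~` below y)) => //; first exact: closed_openC.
by right=> r /not_orP[/negP]; rewrite -leNgt.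
Qed.

(** The image is the block between the end values of the branch: both sets are closed, and they are
    compared on the dense set of points of [X0], whose lifts are unique. *)
Lemma open_s_piece : open (s @` piece i).
Proof.
have [m [m' [mm' m'1 Im Im' [bmm' ivt]]]] := branch_block.
have [ab b1 Ia Ib] := piece_ends.
have [oB cB] := clopen_block Im Im' mm' m'1.
rewrite (_ : s @` piece i = block m m')//; apply/seteqP; split.
  move=> _ [p ip <-]; apply: contrapT => nB.
  have : nbhs p (s @^-1` ~` block m m').
    by apply: s_cont; apply: open_nbhs_nbhs; split => //; exact: closed_openC.
  move=> /(block_dense ab b1 ip)[q [Xq qab]] /=; apply.
  by apply: block_itv; rewrite collapse_s ?bmm'//; exact: block_itv.
move=> z zB; have [_ cp] := clopen_piece.
have : closed (s @` piece i).
  apply: (compact_closed (@hausdorff_X R tau)); apply: continuous_compact.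
    exact: continuous_subspaceT.
  by apply: (@subclosed_compact _ _ setT) => //; exact: compact_X.
apply=> V zV.
have [w [Xw wm Vw]] := block_dense mm' m'1 zB zV.
have [x xab xw] := ivt _ wm.
exists w; split=> //.
have [/andP[a0 _] _ _ _] := piece_ends; case/andP: (xab) => ax xb.
have Ix : I0 tau x.
  split; first by rewrite /unitI /= in_itv /= (le_trans a0 (ltW ax)) (le_trans (ltW xb)).
  have xab' : a <= x <= b by apply/andP; split; exact: ltW.
  by move=> /(I1_branch ic xab').1; rewrite xw; case: Xw.
have [r Xr rx] := X0_ex Ix.
have ir : piece i r by apply: block_itv; rewrite rx.
exists r => //; apply: point_inj; first by rewrite collapse_s// rx.
by rewrite !X0_side//; exact: s_X0.
Qed.

End Piece.

Lemma piece_cover p : exists2 i, (i.+1 < size c)%N & piece i p.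
Proof.
have [_ c1] := pm_partitionP tau_surj.
(* [0 < j] matters for the point 0, which is already [below] 0 but belongs to the first piece. *)
have ex : exists j, (0 < j < size c)%N && `[< below c`_j p >].
  have cM : (0 < M < size c)%N by case: (size c) c1 => [|[|n]] //= _; rewrite ltnSn.
  exists M; rewrite cM /=.
  by apply/asboolP; rewrite (partition_last tau_surj); exact: below1.
have [[|i]// /andP[ic /asboolP ip] imin] := ex_minnP ex.
exists i => //; split=> // ci0 ni.
have := imin i; rewrite ltnn => H; have : (i.+1 <= i)%N; last by rewrite ltnn.
apply: imin; apply/andP; split; last exact/asboolP.
rewrite (ltnW ic) andbT lt0n; apply/eqP => i0.
by rewrite i0 (partition0 tau_surj) ltxx in ci0.
Qed.

Lemma piece_disjoint i j p : (i.+1 < size c)%N -> (j.+1 < size c)%N ->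
  piece i p -> piece j p -> i = j.
Proof.
have H i' j' : (i' < j')%N -> (j'.+1 < size c)%N -> piece i' p -> piece j' p -> False.
  move=> ij jc [ip _] [_ jp]; apply: jp.
    rewrite -[ltLHS](partition0 tau_surj); apply: (partition_lt tau_surj).
    by rewrite (leq_ltn_trans _ ij)//= ltnW.
  by apply: below_le ip; apply: (partition_le tau_surj); rewrite ij ltnW.
move=> ic jc ip jp; case: (ltngtP i j) => // ij.
  by case: (H _ _ ij jc ip jp).
by case: (H _ _ ij ic jp ip).
Qed.

(** The image is compact and contains the dense set [X0]: a preimage under [hat tau] of a point of
    [I0] is again in [I0]. *)
Lemma s_surj q : exists p, s p = q.
Proof.
have cs : closed (s @` [set: X tau]).
  apply: (compact_closed (@hausdorff_X R tau)); apply: continuous_compact.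
    exact: continuous_subspaceT.
  exact: compact_X.
have : (s @` [set: X tau]) q; last by move=> [p _ <-]; exists p.
apply: cs => V qV.
have [||w [Xw w01 Vw]] := block_dense _ _ (block01 q) qV; rewrite ?lexx ?ltr01//.
exists w; split=> //.
have : hat tau unitI (collapse w).
  by rewrite tau_surj /unitI /= in_itv /=; exact: collapse_unit.
move=> /(hatP _ _ _)[i [x [ic Ux xab xw]]].
have Ix : I0 tau x.
  by split=> // /(I1_branch ic xab).1; rewrite xw; case: Xw.
have [r Xr rx] := X0_ex Ix; exists r => //.
have [j jc jr] := piece_cover r.
have rab : c`_i < collapse r < c`_i.+1.
  rewrite rx; case/andP: xab; rewrite !le_eqVlt => /orP[/eqP ax|->] /orP[/eqP xb|-> //].
  - by case: Ix => _ []; rewrite -ax; apply: I1_partition; exact: ltnW.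
  - by case: Ix => _ []; rewrite -ax; apply: I1_partition; exact: ltnW.
  - by case: Ix => _ []; rewrite xb; exact: I1_partition.
have ir : piece i r by exact: block_itv.
apply: point_inj; first by rewrite (collapse_s ic ir) rx.
by rewrite !X0_side//; exact: (s_X0 ic).
Qed.

End AssociatedMap.

(** * Exactness of the interval map and of its lift *)

Section Transfer.
Context {R : realType} (tau : R -> R).
Hypotheses (tau_pm : piecewise_monotonic tau) (tau_surj : hat_surjective tau).
Context (s : X tau -> X tau).
Hypothesis (s_tau : associated_map s).
Local Notation c := (pm_partition tau).
Implicit Types (p q r : X tau) (x y : R) (A : set R).

(** Labels range over partition points rather than pieces; the last one is never taken. *)
Definition label p : 'I_(size c) :=
  Ordinal (ltnW (s2valP (cid2 (piece_cover tau_surj p)))).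

Lemma labelP p : ((label p).+1 < size c)%N /\ piece (label p) p.
Proof. by rewrite /label; case: cid2. Qed.

Lemma label_eq i p : (i.+1 < size c)%N -> piece i p -> label p = i :> nat.
Proof.
by move=> ic ip; have [lc lp] := labelP p; exact: piece_disjoint lp ip.
Qed.

Lemma labelled_covering_s : labelled_covering s label.
Proof.
have s_cont : continuous s := s_tau.1.
split.
- exact: hausdorff_X.
- exact: compact_X.
- exact: s_cont.
(* By injectivity on a piece, the image of its part in [U] is the open image of the piece minus the
   compact image of its part outside [U]. *)
- move=> U oU; rewrite (_ : s @` U = \bigcup_(i in [set i | (i.+1 < size c)%N])
      (s @` piece i `&` ~` (s @` (piece i `\` U)))); last first.
    apply/seteqP; split=> [_ [p Up <-]|_ [i ic [[p ip <-] np]]].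
      have [lc lp] := labelP p; exists (label p) => //; split; first by exists p.
      move=> [q [lq nUq] sqp]; apply: nUq.
      by rewrite (s_inj_piece tau_pm tau_surj s_tau lc lq lp sqp).
    exists p => //; apply: contrapT => nUp; apply: np; by exists p.
  apply: bigcup_open => i ic; have [oP cP] := clopen_piece tau_surj ic.
  apply: openI; first exact: open_s_piece.
  apply: closed_openC; apply: (compact_closed (@hausdorff_X R tau)).
  apply: continuous_compact; first exact: continuous_subspaceT.
  apply: (@subclosed_compact _ _ setT) => //; last exact: compact_X.
  by apply: closedI => //; exact: open_closedC.
- exact: s_surj.
- move=> p; have [lc lp] := labelP p.
  have [oP _] := clopen_piece tau_surj lc.
  have pP : nbhs p (piece (label p)) by exact: open_nbhs_nbhs.
  by apply: (@filterS (X tau) (nbhs p) _ _ _ _ pP) => q lq; apply: val_inj; exact: label_eq.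
- move=> p q pq; have [lc lp] := labelP p; have [_ lq] := labelP q.
  by apply: (s_inj_piece tau_pm tau_surj s_tau lc) => //; rewrite pq.
Qed.

Lemma collapse_s_hat p A : A (collapse p) -> hat tau A (collapse (s p)).
Proof.
move=> Ap; have [lc lp] := labelP p.
rewrite (collapse_s tau_pm tau_surj s_tau lc lp).
by apply: hat_branch => //; exact: piece_collapse.
Qed.

Lemma iter_hat_unit n A : A `<=` unitI -> iter n (hat tau) A `<=` unitI.
Proof. by move=> AI; elim: n => // n ih; exact: hat_unit. Qed.

Lemma exact_collapse : 
  (forall (b : X tau -> R) p, continuous b -> (forall q, 0 <= b q) -> 0 < b p ->
    exists n, iter n s @` [set q | 0 < b q] = setT) -> topologically_exact tau.
Proof.
move=> ex U oU [x [Ux Ix]].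
have x01 : 0 <= x <= 1 by move: Ix; rewrite /unitI /= in_itv.
have [p px _] := exists_left tau x01.
have /nbhs_ballP[e e0 eU] : nbhs x U by exact: open_nbhs_nbhs.
(* A tent function, positive exactly over the ball of radius [e] about [x]. *)
pose b q : R := Num.max 0 (e - `|x - collapse q|).
have cb : continuous b.
  have cg : continuous (fun y : R => Num.max 0 (e - `|x - y|)).
    move=> y; apply: (@continuous_max _ _ (fun=> 0) (fun y => e - `|x - y|)).
      exact: cvg_cst.
    apply: cvgB; first exact: cvg_cst.
    by apply: cvg_norm; apply: cvgB; [exact: cvg_cst|exact: cvg_id].
  move=> q; apply: (@continuous_comp _ _ _ (@collapse R tau)
    (fun y : R => Num.max 0 (e - `|x - y|))).
    exact: collapse_continuous.
  exact: cg.
have b0 q : 0 <= b q by rewrite le_max lexx.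
have [|n bn] := ex b p cb b0; first by rewrite /b px subrr normr0 subr0 lt_max e0 orbT.
exists n; apply/seteqP; split; first by apply: iter_hat_unit => y [].
move=> y; rewrite /unitI /= in_itv /= => y01.
have [q qy _] := exists_left tau y01.
have [r br rq] : (iter n s @` [set q | 0 < b q]) q by rewrite bn.
rewrite -qy -rq; elim: n {bn rq} => [|n ih] /=; last exact: collapse_s_hat.
split; last by rewrite /unitI /= in_itv /=; exact: collapse_unit.
by apply: eU; move: br; rewrite /= /b lt_max ltxx subr_gt0.
Qed.

(* Points of [I0] only have preimages in [I0], where [hat tau] is [tau] and lifts
   to [s]. *)
Lemma iter_hat_X0 n A y : A `<=` unitI -> iter n (hat tau) A y -> I0 tau y ->
  exists p, [/\ X0 p, A (collapse p), X0 (iter n s p) & collapse (iter n s p) = y].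
Proof.
move=> AI; elim: n y => [|n ih] y /=.
  by move=> Ay Iy; have [p Xp py] := X0_ex Iy; exists p; rewrite py.
move=> /hatP[i [x [ic nx xab xy]]] Iy.
have Ix : I0 tau x.
  split; first exact: iter_hat_unit nx.
  by move=> /(I1_branch ic xab).1; rewrite xy; case: Iy.
have [p [Xp Ap Xs ps]] := ih x nx Ix.
have xab' : c`_i < x < c`_i.+1.
  case/andP: xab; rewrite !le_eqVlt => /orP[/eqP ax|->] /orP[/eqP xb|-> //].
  - by case: Ix => _ []; rewrite -ax; apply: I1_partition; exact: ltnW.
  - by case: Ix => _ []; rewrite -ax; apply: I1_partition; exact: ltnW.
  - by case: Ix => _ []; rewrite xb; exact: I1_partition.
have ip : piece i (iter n s p) by apply: block_itv; rewrite ps.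
exists p; split=> //; first exact: (s_X0 tau_pm tau_surj s_tau ic).
by rewrite (collapse_s tau_pm tau_surj s_tau ic ip) ps.
Qed.

Lemma exact_s : topologically_exact tau -> forall U : set (X tau), open U ->
  U !=set0 -> exists n, iter n s @` U = setT.
Proof.
move=> ex U oU [p Up].
have pU : nbhs p U by exact: open_nbhs_nbhs.
have i01 : 0 <= (0 : R) < 1 by rewrite lexx ltr01.
have [a [b [a0 ab b1 abU]]] := nbhs_block i01 (lexx _) (block01 p) pU.
pose a' := (a + a + b) / 3; pose b' := (a + b + b) / 3.
have aa' : a < a' by rewrite /a'; lra.
have a'b' : a' < b' by rewrite /a' /b'; lra.
have b'b : b' < b by rewrite /b'; lra.
pose V : set R := `]a', b'[%classic.
have oV : open V by exact: interval_open.
have [|n nV] := ex V oV.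
  exists ((a' + b') / 2); split; first by rewrite /V /= in_itv /=; apply/andP; split; lra.
  by rewrite /unitI /= in_itv /=; apply/andP; split; lra.
exists n; apply/seteqP; split=> // q _.
(* Lifting orbits of [tau] reaches only points of [X0]. A compact set inside [U] has a closed image,
   so density of [X0] gives the rest. *)
pose K : set (X tau) := @collapse R tau @^-1` `[a', b'].
have cK : closed (iter n s @` K).
  apply: (compact_closed (@hausdorff_X R tau)); apply: continuous_compact.
    by apply: continuous_subspaceT; exact: (iter_continuous labelled_covering_s).
  apply: (@subclosed_compact _ _ setT) => //; last exact: compact_X.
  apply: closed_comp => [r _|]; first exact: collapse_continuous.
  exact: itv_closed.
suff [r Kr rq] : (iter n s @` K) q.
  exists r => //; apply: abU; move: Kr; rewrite /K /= in_itv /= => /andP[ar rb].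
  by rewrite (lt_le_trans aa') ?(le_lt_trans rb).
apply: cK => B qB.
have [w [Xw _ Bw]] := block_dense tau_pm tau_surj i01 (lexx _) (block01 q) qB.
exists w; split => //.
have VI : V `&` unitI `<=` unitI by move=> ? [].
have nw : iter n (hat tau) (V `&` unitI) (collapse w).
  by rewrite nV /unitI /= in_itv /=; exact: collapse_unit.
have [r [_ [Vr _] Xr rw]] := iter_hat_X0 VI nw Xw.
exists r; last by apply: point_inj => //; rewrite !X0_side.
by move: Vr; rewrite /V /K /= !in_itv /= => /andP[ar rb]; rewrite !ltW.
Qed.

End Transfer.

Theorem proposition5p2 (R : realType) (tau : R -> R)
    (tau_pm : piecewise_monotonic tau) (tau_surj : hat_surjective tau)
    (A : cstarAlgebra R) (A_F : is_F tau A) :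
  cstar_simple A <-> topologically_exact tau.
Proof.
have [s s_tau [N cN [iota ci]]] := A_F.
have sL := labelled_covering_s tau_pm tau_surj s_tau.
split=> [simA|ex].
  apply: (exact_collapse tau_pm tau_surj s_tau) => b p cb b0 bp.
  exact: (simple_exact sL cN ci simA cb b0 bp).
have i01 : 0 <= (0 : R) <= 1 by rewrite lexx ler01.
have [p _ _] := exists_left tau i01.
by apply: (exact_simple sL cN ci p); exact: exact_s.
Qed.
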